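(* Let $D$ be a link diagram containing the two-crossing side of a second Reidemeister move with crossings $a,b$, and let $\operatorname{in}\circ\rho_2:\mathcal C(D)\to\mathcal C(D)$ be the map $\rho_2$ of the context followed by the inclusion $\operatorname{in}$. Define an $R$-linear map $h_2:\mathcal C(D)\to\mathcal C(D)$ by $$h_2\bigl(E_{--}(p,q)\otimes[xab]\bigr)=-E^{-}_{+-}(p,q)\otimes[xb],\qquad h_2\bigl(E^{+}_{+-}(p,q)\otimes[xb]\bigr)=E_{++}(p,q)\otimes[x],$$ and $h_2=0$ on all generators of the other types. Then $$\delta_{s,t}\circ h_2+h_2\circ\delta_{s,t}=\operatorname{id}-\operatorname{in}\circ\rho_2 ,$$ i.e. $h_2$ is a chain homotopy connecting $\operatorname{in}\circ\rho_2$ to the identity.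
   Context: **The complex.** Let $R=\mathbb Z[s,t]$ and let $D$ be an oriented link diagram. At each crossing a marker is chosen: the positive marker is the $A$-smoothing and the negative marker is the $A^{-1}$-smoothing of the Kauffman bracket $\langle D_\times\rangle=A\langle D_0\rangle+A^{-1}\langle D_\infty\rangle$. An enhanced state $S$ is a choice of a marker at each crossing together with a sign $+$ or $-$ on each circle of the smoothed diagram (state circle). An oriented enhanced state is $S\otimes[x]$ where $x$ is a sequence listing each negative-marker crossing of $S$ exactly once; if $x'$ is a permutation of $x$ then $S\otimes[x']=\pm S\otimes[x]$, with sign the sign of the permutation. $\mathcal C(D)=\bigoplus_i\mathcal C^i(D)$ is the free $R$-module generated by oriented enhanced states modulo these relations; $\mathcal C^i(D)$ is spanned by states with $i(S)=(w(D)-\sigma(S))/2=i$, where $w(D)$ is the writhe and $\sigma(S)$ is the number of positive markers minus the number of negative markers. Let $V$ be the free $R$-module on the signs $+,-$, with commutative bilinear product $m(+:+)=s\,(+)+t\,(-)$, $m(+:-)=m(-:+)=+$, $m(-:-)=-$, and coproduct $\Delta(+)=(+)\otimes(+)+t\,(-)\otimes(-)$, $\Delta(-)=(+)\otimes(-)+(-)\otimes(+)-s\,(-)\otimes(-)$. The map $\delta_{s,t}:\mathcal C^i(D)\to\mathcal C^{i+1}(D)$ is $\delta_{s,t}(S\otimes[x])=\sum_a S_a\otimes[xa]$, the sum over crossings $a$ with positive marker in $S$, where $S_a$ is the combination of enhanced states obtained by making the marker at $a$ negative: if two circles with signs $p,q$ merge, the new circle is labelled $m(p:q)$; if a circle with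 sign $p$ splits, the two new circles are labelled by $\Delta(p)$; other signs are unchanged. Labels are extended $R$-linearly. It is known that $\delta_{s,t}^2=0$. **The local picture.** Inside a disk with boundary points $NW,NE,SW,SE$, $D$ consists of a strand joining $SW$ to $NW$ bulging right, which passes over a strand joining $SE$ to $NE$ bulging left, with top crossing $a$ and bottom crossing $b$. ''Horizontal'' smoothing of a crossing means $\asymp$ (one cap above the other), ''vertical'' means $)($. At $a$ the horizontal smoothing is positive and the vertical one negative; at $b$ the vertical smoothing is positive and the horizontal one negative. Let $x$ be a sequence of the negative-marker crossings outside the disk. The generators of $\mathcal C(D)$ are: - $E_{++}(p,q)\otimes[x]$: both markers positive; arc $NW$–$NE$ labelled $p$, arc $SW$–$SE$ labelled $q$. - $E_{-+}(p,q)\otimes[xa]$: $a$ negative, $b$ positive; arc $NW$–$SW$ labelled $p$, arc $NE$–$SE$ labelled $q$. - $E^{\epsilon}_{+-}(p,q)\otimes[xb]$, $\epsilon=\pm$: $a$ positive, $b$ negative; arc $NW$–$NE$ labelled $p$, arc $SW$–$SE$ labelled $q$, and a small circle inside the disk with sign $\epsilon$. - $E_{--}(p,q)\otimes[xab]$: both negative; arc $NW$–$NE$ labelled $p$, arc $SW$–$SE$ labelled $q$. The label of an arc is the sign of the state circle containing it (so $p=q$ if both arcs lie on the same circle); markers outside the disk are arbitrary and the same in all terms of a formula, and signs of circles not meeting the disk are arbitrary and the same in all terms. **Notation $p:q$.** If two arcs with labels $p,q$ are replaced via a saddle ($\asymp$ to $)($ or $)($ to $\asymp$), the new arcs are labelled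 $p:q$ and $q:p$; an expression such as $E(p:q,q:p)$ denotes the $R$-linear combination of enhanced states obtained by the merge (via $m$) or split (via $\Delta$) of the state circles involved. Thus $E((p:q):(q:p),(q:p):(p:q))$ denotes the result of applying the saddle twice, $\asymp\to )(\to\asymp$ (or the reverse). **The map $\rho_2$.** $\mathcal C\subset\mathcal C(D)$ is the submodule generated by all $E_{-+}(p,q)\otimes[xa]+E^{-}_{+-}(p:q,q:p)\otimes[xb]$. The $R$-linear map $\rho_2:\mathcal C(D)\to\mathcal C$ is $$\rho_2(E_{-+}(p,q)\otimes[xa])=E_{-+}(p,q)\otimes[xa]+E^{-}_{+-}(p:q,q:p)\otimes[xb],$$ $$\rho_2(E^{+}_{+-}(p,q)\otimes[xb])=-E_{-+}(p:q,q:p)\otimes[xa]-E^{-}_{+-}\bigl((p:q):(q:p),(q:p):(p:q)\bigr)\otimes[xb],$$ and $\rho_2=0$ on the other generators. *)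

(* Defs.v *)
From HB Require Import structures.
From mathcomp Require Import all_boot all_order all_algebra all_fingroup.
From mathcomp.classical Require Import boolp.
From mathcomp.multinomials Require Import mpoly.

Set Implicit Arguments.
Unset Strict Implicit.
Unset Printing Implicit Defensive.

Import GRing.Theory.
Local Open Scope ring_scope.

Notation Zst := {mpoly int[2]}.
Definition ps : Zst := 'X_ord0.
Definition pt : Zst := 'X_ord_max.

(* The submodule generated by G: the smallest one that contains G. *)
Definition submod_gen (R : pzRingType) (V : lmodType R) (G : V -> Prop)
    : {pred V} :=
  fun u => `[< forall W : {pred V}, GRing.submod_closed W ->
               (forall g, G g -> g \in W) -> u \in W >].

Section SubmodGen.
Variables (R : pzRingType) (V : lmodType R) (G : V -> Prop).

Lemma submod_gen_closed : GRing.submod_closed (submod_gen G).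
Proof.
split=> [|a u v /asboolP Hu /asboolP Hv]; apply/asboolP => W HW HG.
  by case: HW.
by case: (HW) => _; apply; [apply: Hu | apply: Hv].
Qed.

HB.instance Definition _ :=
  GRing.isSubmodClosed.Build R V (submod_gen G) submod_gen_closed.

Lemma submod_gen_mem g : G g -> g \in submod_gen G.
Proof. by move=> Gg; apply/asboolP => W _; apply. Qed.
End SubmodGen.

Lemma perm_on_mem (T : finType) (x : seq T) (s : {perm T}) :
  perm_on [set c in x] s -> [seq s c | c <- x] =i x.
Proof.
move=> xs c; have := perm_closed ((s^-1)%g c) xs.
rewrite permKV !inE => ->; rewrite -{1}[c](permKV s) mem_map //.
exact: perm_inj.
Qed.

Lemma perm_on_sub (T : finType) (x y : seq T) (s : {perm T}) :
  {subset x <= y} -> perm_on [set c in x] s -> perm_on [set c in y] s.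
Proof.
by move=> xy xs; apply: subset_trans xs _; apply/subsetP => c; rewrite !inE => /xy.
Qed.

Lemma perm_on_notin (T : finType) (x : seq T) (s : {perm T}) c :
  perm_on [set c in x] s -> c \notin x -> s c = c.
Proof. by move=> xs cx; apply: (out_perm xs); rewrite inE. Qed.

(* Sign of the permutation carrying x to y. *)
Definition perm_sign (T : finType) (x y : seq T) : Zst :=
  if [pick s : {perm T} |
        perm_on [set c in x] s && ([seq s c | c <- x] == y)] is Some s
  then (-1) ^+ s else 0.

Lemma perm_signE (T : finType) (x : seq T) (s : {perm T}) :
  perm_on [set c in x] s -> perm_sign x [seq s c | c <- x] = (-1) ^+ s.
Proof.
rewrite /perm_sign => xs; case: pickP => [t|/(_ s)]; last by rewrite xs eqxx.
case/andP=> xt /eqP/eq_in_map st; congr ((-1) ^+ odd_perm _).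
apply/permP => c; have [/st//|cx] := boolP (c \in x).
by rewrite (perm_on_notin xs) // (perm_on_notin xt).
Qed.

Lemma perm_signP (T : finType) (x y : seq T) : uniq x -> perm_eq x y ->
  exists2 s : {perm T}, perm_on [set c in x] s & y = [seq s c | c <- x].
Proof.
move=> xu xy; have yu : uniq y by rewrite -(perm_uniq xy).
have sxy : size x = size y := perm_size xy.
pose f c := if c \in x then nth c y (index c x) else c.
have fx c : c \in x -> f c \in x.
  by move=> cx; rewrite /f cx (perm_mem xy) mem_nth // -sxy index_mem.
have f_inj : injective f.
  move=> c d; have [cx|cx] := boolP (c \in x); have [dx|dx] := boolP (d \in x).
  - rewrite /f cx dx (set_nth_default c d) -?sxy ?index_mem // => /eqP.
    rewrite nth_uniq -?sxy ?index_mem // => /eqP e.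
    by rewrite -(nth_index c cx) e nth_index.
  - by move=> e; move: (fx _ cx); rewrite e /f (negPf dx) (negPf dx).
  - by move=> e; move: (fx _ dx); rewrite -e /f (negPf cx) (negPf cx).
  - by rewrite /f (negPf cx) (negPf dx).
exists (perm f_inj).
  apply/subsetP => c; rewrite !inE permE; apply: contraR => cx.
  by rewrite /f (negPf cx).
case Dx: x => [|c0 x']; first by move: sxy; rewrite Dx; case: (y).
rewrite -Dx; apply: (@eq_from_nth _ c0); first by rewrite size_map.
move=> i; rewrite -sxy => ix; rewrite (nth_map c0) // permE /f mem_nth //.
by rewrite index_uniq //; apply: set_nth_default; rewrite -sxy.
Qed.

(* A crossing has four half-edges, numbered counterclockwise by 'Z_4 so that
   the under strand is {0, 2} and the over strand is {1, 3}. *)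
Notation darts T := (T * 'Z_4)%type.

Definition turn (T : Type) (k : 'Z_4) (d : darts T) : darts T :=
  (d.1, d.2 + k).

(* Combinatorial planarity: Euler's formula V - E + F = 2 C, with C the number
   of connected components, in the form E + V + F = #|darts| + 2 C, where
   #|darts| = 2 E. *)
Definition planar (T : finType) (edge : darts T -> darts T) : Prop :=
  (fcard edge {: darts T} + fcard (turn 1%R) {: darts T}
     + fcard (turn 1%R \o edge) {: darts T}
   = #|{: darts T}|
     + 2 * n_comp (fun d e => (e == edge d) || (e == turn 1%R d)) {: darts T})%N.

(* A link diagram is a planar 4-valent map with over/under data, together with
   crossingless components.  The orientation of the link is given by
   outgoing d, meaning that the strand through d leaves the crossing along d;
   orientations of crossingless components play no role in the writhe and are
   not recorded. *)
Record link_diagram := LinkDiagram {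
  crossing : finType;
  edge : darts crossing -> darts crossing;
  nfree : nat;
  outgoing : darts crossing -> bool;
  edgeK : involutive edge;
  edge_neq : forall d, edge d != d;
  edge_planar : planar edge;
  outgoing_edge : forall d, outgoing (edge d) = ~~ outgoing d;
  outgoing_turn : forall d, outgoing (turn 2 d) = ~~ outgoing d
}.

Notation dart D := (darts (crossing D)).
Notation strand D := (dart D + 'I_(nfree D))%type.

Section States.
Variable D : link_diagram.
Implicit Types (a c : crossing D) (d : dart D).

(* The positive marker (true) is the A-smoothing: it joins the two regions
   swept by the over strand when turned counterclockwise, so it connects 0 with
   1 and 2 with 3.  The negative marker connects 1 with 2 and 3 with 0. *)
Definition smooth (m : {ffun crossing D -> bool}) d : dart D :=
  if m d.1 (+) odd d.2 then turn 1 d else turn (-1) d.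

Definition adjacent (m : {ffun crossing D -> bool}) : rel (strand D) :=
  fun u v => match u, v with
             | inl d, inl e => (e == edge d) || (e == smooth m d)
             | _, _ => false
             end.

(* The state circles are the classes of this relation. *)
Definition same_circle (m : {ffun crossing D -> bool}) : rel (strand D) :=
  connect (adjacent m).

(* Markers, and a sign for each state circle given as a function constant on
   the circles; true stands for +. *)
Definition estate :=
  {S : {ffun crossing D -> bool} * {ffun strand D -> bool} |
    [forall u, forall v, same_circle S.1 u v ==> (S.2 u == S.2 v)]}.

HB.instance Definition _ := Finite.on estate.

Definition marker (S : estate) : {ffun crossing D -> bool} := (val S).1.
Definition label (S : estate) : {ffun strand D -> bool} := (val S).2.

Definition listing (S : estate) (x : seq (crossing D)) : bool :=
  uniq x && [forall c, (c \in x) == ~~ marker S c].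

(* Oriented enhanced states; the bound on the length holds for every listing. *)
Definition ostate :=
  {o : estate * #|crossing D|.-bseq (crossing D) | listing o.1 o.2}.

HB.instance Definition _ := Finite.on ostate.

Definition free_chain := {ffun ostate -> Zst^o}.

HB.instance Definition _ := GRing.Lmodule.on free_chain.

Definition free_gen (S : estate) (x : seq (crossing D)) : free_chain :=
  [ffun o : ostate =>
    (((val o).1 == S) && ((val o).2 == x :> seq (crossing D)))%:R].

(* The permutation s of the entries of x carries x to [seq s c | c <- x]. *)
Definition sign_rel : free_chain -> Prop := fun u =>
  exists (S : estate) (x : seq (crossing D)) (s : {perm crossing D}),
    [/\ listing S x, perm_on [set c in x] s
      & u = free_gen S [seq s c | c <- x] - (-1) ^+ s *: free_gen S x].

Definition chain := Quotient.quot (submod_gen sign_rel).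

HB.instance Definition _ := GRing.Zmodule.on chain.
HB.instance Definition _ := Quotient.on chain.

Local Notation pi := (\pi_chain%qT).

Lemma pi_eq0 u : (pi u == 0) = (u \in submod_gen sign_rel).
Proof.
rewrite -[u in RHS]subr0.
have <- : pi 0 = 0 by rewrite raddf0.
by rewrite [RHS](Quotient.idealrBE (submod_gen sign_rel)).
Qed.

Definition chain_scale (k : Zst) (v : chain) : chain := pi (k *: generic_quotient.repr v).

Lemma pi_scale k u : pi (k *: u) = chain_scale k (pi u).
Proof.
apply/eqP; rewrite /chain_scale -subr_eq0 -raddfB pi_eq0 -scalerBr rpredZ //.
by rewrite -pi_eq0 raddfB /= reprK subrr.
Qed.

Lemma chain_scaleA k l v : chain_scale k (chain_scale l v)
  = chain_scale (k * l) v.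
Proof.
by rewrite -[v]reprK -(pi_scale l) -(pi_scale k) -(pi_scale (k * l)) scalerA.
Qed.

Lemma chain_scale1 : left_id 1 chain_scale.
Proof. by move=> v; rewrite -[v]reprK -pi_scale scale1r. Qed.

Lemma chain_scaleDr : right_distributive chain_scale +%R.
Proof.
move=> k u v; rewrite -[u]reprK -[v]reprK -raddfD.
by rewrite -(pi_scale k (_ + _)) -!(pi_scale k (generic_quotient.repr _))
  -raddfD scalerDr.
Qed.

Lemma chain_scaleDl v : {morph chain_scale^~ v : k l / k + l}.
Proof. move=> k l; rewrite -[v]reprK -(pi_scale (k + l)) -(pi_scale k) -(pi_scale l).
by rewrite -raddfD scalerDl. Qed.

HB.instance Definition _ := GRing.Zmodule_isLmodule.Build Zst chain
  chain_scaleA chain_scale1 chain_scaleDr chain_scaleDl.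

(* S (x) [x] *)
Definition gen (S : estate) (x : seq (crossing D)) : chain :=
  pi (free_gen S x).

Lemma pi_gen_scale k u : pi (k *: u) = k *: pi u.
Proof. exact: pi_scale. Qed.

Lemma listing_map S x (s : {perm crossing D}) :
  perm_on [set c in x] s -> listing S [seq s c | c <- x] = listing S x.
Proof.
move=> xs; rewrite /listing map_inj_uniq; last exact: perm_inj.
by congr (_ && _); apply: eq_forallb => c; rewrite perm_on_mem.
Qed.

Lemma listing_marker S x c : listing S x -> (c \in x) = ~~ marker S c.
Proof. by case/andP=> _ /forallP/(_ c)/eqP. Qed.

Lemma gen_nlisting S x : ~~ listing S x -> gen S x = 0.
Proof.
move=> Sx; rewrite /gen; have -> : free_gen S x = 0; last by rewrite raddf0.
apply/ffunP => -[[T y] Ty]; rewrite !ffunE /=.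
by case: eqP => //= eT; case: eqP => //= ey; move: Sx; rewrite -eT -ey Ty.
Qed.

Lemma gen_perm S x (s : {perm crossing D}) : perm_on [set c in x] s ->
  gen S [seq s c | c <- x] = (-1) ^+ s *: gen S x.
Proof.
move=> xs; have [Sx|Sx] := boolP (listing S x); last first.
  by rewrite !gen_nlisting ?scaler0 // listing_map.
apply/eqP; rewrite -subr_eq0 -pi_gen_scale -raddfB pi_eq0.
by apply: submod_gen_mem; exists S, x, s.
Qed.

(* The R-linear map with prescribed values on the oriented enhanced states. *)
Section Extension.
Variables (W : lmodType Zst) (f : estate -> seq (crossing D) -> W).

Definition free_extend (u : free_chain) : W :=
  \sum_(o : ostate) (u o : Zst) *: f (val o).1 (val o).2.

Definition extend (v : chain) : W := free_extend (generic_quotient.repr v).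

Definition sign_compatible : Prop :=
  forall S x (s : {perm crossing D}), listing S x -> perm_on [set c in x] s ->
    f S [seq s c | c <- x] = (-1) ^+ s *: f S x.

Lemma free_extend_linear k u v :
  free_extend (k *: u + v) = k *: free_extend u + free_extend v.
Proof.
rewrite /free_extend scaler_sumr -big_split; apply: eq_bigr => o _ /=.
by rewrite !ffunE scalerDl scalerA.
Qed.

Lemma free_extend_gen S x : listing S x -> free_extend (free_gen S x) = f S x.
Proof.
move=> Sx; have /andP[xu _] := Sx.
have xn : (size x <= #|crossing D|)%N by rewrite -(card_uniqP xu) max_card.
pose o : ostate := exist _ (S, Bseq xn) Sx.
rewrite /free_extend (bigD1 o) //= ffunE /= !eqxx scale1r.
rewrite big1 ?addr0 // => -[[T y] Ty] /=; rewrite ffunE /= => To.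
case: eqP => [eT|]; last by rewrite scale0r.
case: eqP => [ey|]; last by rewrite scale0r.
case/eqP: To; apply: val_inj; rewrite /= eT; congr (_, _); exact: val_inj.
Qed.

Hypothesis fP : sign_compatible.

Lemma extend_pi u : extend (pi u) = free_extend u.
Proof.
have HW : GRing.submod_closed [pred v | free_extend v == 0].
  split=> [|k v w]; rewrite !inE.
    by apply/eqP; apply: big1 => o _; rewrite ffunE scale0r.
  by move=> /eqP v0 /eqP w0; rewrite free_extend_linear v0 w0 scaler0 addr0.
have /eqP : \pi_chain%qT (generic_quotient.repr (pi u) - u) = 0.
  by rewrite raddfB /= reprK subrr.
rewrite pi_eq0 => /asboolP/(_ _ HW) => /(_ _)/eqP H.
have {H} : free_extend (generic_quotient.repr (pi u) - u) = 0.
  apply: H => g [S [x [s [Sx xs ->]]]]; rewrite inE -scaleN1r addrC scalerA.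
  rewrite free_extend_linear !free_extend_gen ?listing_map // fP //.
  by rewrite mulN1r scaleNr addrC subrr.
rewrite -scaleN1r addrC free_extend_linear scaleN1r addrC => /eqP.
by rewrite subr_eq0 => /eqP.
Qed.

Lemma extend_gen S x : listing S x -> extend (gen S x) = f S x.
Proof. by move=> Sx; rewrite extend_pi free_extend_gen. Qed.

Lemma extend_linear : linear extend.
Proof.
move=> k u v; rewrite -[u]reprK -[v]reprK -pi_gen_scale -raddfD.
by rewrite !extend_pi free_extend_linear.
Qed.
End Extension.

(* Structure constants: coefficient of r in m(p : q), and of q (x) r in
   Delta(p). *)
Definition mcoef (p q r : bool) : Zst :=
  match p, q with
  | true, true => if r then ps else pt
  | false, false => if r then 0 else 1
  | _, _ => if r then 1 else 0
  end.

Definition dcoef (p q r : bool) : Zst :=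
  match p, q, r with
  | true, true, true => 1
  | true, false, false => pt
  | false, true, false => 1
  | false, false, true => 1
  | false, false, false => - ps
  | _, _, _ => 0
  end.

(* Markers outside X and signs of the circles of S not meeting X agree. *)
Definition outside_eq (X : {set crossing D}) (S T : estate) : bool :=
  [forall c, (c \in X) || (marker T c == marker S c)] &&
  [forall u, [exists d : dart D, (d.1 \in X) &&
                same_circle (marker S) u (inl d)]
             || (label T u == label S u)].

(* Coefficient of T in the result of a saddle applied to S, where the markers
   of T are those obtained by the saddle, the saddle takes place at the
   crossings in X, and u, v are half-edges that lie on the two arcs involved
   before the saddle, and on the two new arcs after it.  If u and v lie on
   different circles of S these merge, otherwise their circle splits. *)
Definition saddle (X : {set crossing D}) (u v : dart D) (S T : estate) : Zst :=
  if outside_eq X S T then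
    if same_circle (marker S) (inl u) (inl v)
    then dcoef (label S (inl u)) (label T (inl u)) (label T (inl v))
    else mcoef (label S (inl u)) (label S (inl v)) (label T (inl u))
  else 0.

(* The half-edges 0 and 2 of a crossing are on distinct arcs of either
   smoothing. *)
Definition delta_gen (S : estate) (x : seq (crossing D)) : chain :=
  \sum_(a | marker S a) \sum_(T | ~~ marker T a)
    saddle [set a] (a, 0) (a, 2) S T *: gen T (rcons x a).

Definition delta : chain -> chain := extend delta_gen.

Lemma delta_compatible : sign_compatible delta_gen.
Proof.
move=> S x s Sx xs; rewrite /delta_gen scaler_sumr; apply: eq_bigr => a Sa.
rewrite scaler_sumr; apply: eq_bigr => T _.
have ax : a \notin x by rewrite (listing_marker _ Sx) Sa.
have -> : rcons [seq s c | c <- x] a = [seq s c | c <- rcons x a].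
  by rewrite map_rcons (perm_on_notin xs ax).
rewrite gen_perm; last first.
  by apply: perm_on_sub xs => c cx; rewrite mem_rcons inE cx orbT.
by rewrite !scalerA mulrC.
Qed.

HB.instance Definition _ := GRing.isLinear.Build Zst chain chain _ delta
  (extend_linear delta_compatible).

Lemma deltaE S x : listing S x -> delta (gen S x) =
  \sum_(a | marker S a) \sum_(T | ~~ marker T a)
    saddle [set a] (a, 0) (a, 2) S T *: gen T (rcons x a).
Proof. exact: (extend_gen delta_compatible). Qed.

(* A crossing is positive if the over strand, turned counterclockwise by a
   right angle, points in the direction of the under strand. *)
Definition writhe : int :=
  \sum_(c : crossing D)
    (if outgoing (c, 1 : 'Z_4) == outgoing (c, 2 : 'Z_4) then 1 else -1).

Definition sigma (S : estate) : int := \sum_c (if marker S c then 1 else -1).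

(* The division is exact: both terms have the parity of the number of
   crossings. *)
Definition state_degree (S : estate) : int := ((writhe - sigma S) %/ 2)%Z.

Definition chain_deg (i : int) : {pred chain} :=
  submod_gen (fun u => exists (S : estate) (x : seq (crossing D)),
    [/\ listing S x, state_degree S = i & u = gen S x]).

End States.

Arguments gen {D} S x.
Arguments delta {D} v.
Arguments chain_deg {D} i.

(* The disk of the second Reidemeister move: ne is the end NE at the top
   crossing a and se the end SE at the bottom crossing b, both on the under
   strand.  Counterclockwise, a has the ends NE, NW and then two half-edges
   leading to b, and b has the ends SE, then two half-edges leading to a, then
   SW.  The two edges from a to b bound a bigon since the left one joins
   turn 2 ne to turn 2 se and the right one joins turn 3 ne to turn 1 se. *)
Record R2_site (D : link_diagram) := R2Site {
  ne : dart D;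
  se : dart D;
  ne_under : ~~ odd ne.2;
  se_under : ~~ odd se.2;
  site_neq : ne.1 != se.1;
  left_edge : edge (turn 2 ne) = turn 2 se;
  right_edge : edge (turn 3 ne) = turn 1 se
}.

Section Site.
Variables (D : link_diagram) (X : R2_site D).
Local Notation a := (ne X).1.
Local Notation b := (se X).1.
Local Notation nw := (turn 1 (ne X)).
Local Notation C := (chain D).

(* E_{++}, E_{-+}, E_{+-}, E_{--}: the markers at a and b. *)
Definition site_type (S : estate D) (ma mb : bool) : bool :=
  (marker S a == ma) && (marker S b == mb).

(* The sign of the small circle of a state of type E_{+-}. *)
Definition small_sign (S : estate D) : bool := label S (inl (turn 2 (ne X))).

Definition inner (u : strand D) : bool :=
  u \in [:: inl (turn 2 (ne X)); inl (turn 3 (ne X));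
            inl (turn 1 (se X)); inl (turn 2 (se X))].

(* S and T are of types among E_{++}(p,q), E_{+-}(p,q), E_{--}(p,q), with the
   same outside part and the same labels p and q; given S, exactly one T of
   each type (and small sign, for the type E_{+-}) satisfies this. *)
Definition same_ends (S T : estate D) : bool :=
  [forall c, (c \in [set a; b]) || (marker T c == marker S c)] &&
  [forall u, inner u || (label T u == label S u)].

(* The end NW and the end SE lie on different arcs, both for the horizontal and
   for the vertical smoothing, so that they carry p and q in E(p,q) as well as
   p : q and q : p in E(p : q, q : p). *)
Definition site_saddle (S T : estate D) : Zst :=
  saddle [set a; b] nw (se X) S T.

(* E^-_{+-}(p : q, q : p) (x) [xb], for S = E_{-+}(p,q) *)
Definition saddle_pm (S : estate D) (x : seq (crossing D)) : C :=
  \sum_(T | site_type T true false && ~~ small_sign T)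
    site_saddle S T *: gen T (rcons x b).

(* E_{-+}(p : q, q : p) (x) [xa], for S = E^+_{+-}(p,q) *)
Definition saddle_mp (S : estate D) (x : seq (crossing D)) : C :=
  \sum_(T | site_type T false true) site_saddle S T *: gen T (rcons x a).

(* E^-_{+-}((p : q) : (q : p), (q : p) : (p : q)) (x) [xb], for
   S = E^+_{+-}(p,q) *)
Definition double_saddle (S : estate D) (x : seq (crossing D)) : C :=
  \sum_(T | site_type T false true) site_saddle S T *: saddle_pm T x.

Definition outer (x : seq (crossing D)) : seq (crossing D) :=
  [seq c <- x | c \notin [:: a; b]].

(* The value at S (x) [x] of a map sending S (x) [y ++ w] to f S y, where w lists
   the negative-marker crossings of S inside the disk. *)
Definition site_value (f : estate D -> seq (crossing D) -> C)
    (S : estate D) (w x : seq (crossing D)) : C :=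
  perm_sign (outer x ++ w) x *: f S (outer x).

Definition h2_mm (S : estate D) (y : seq (crossing D)) : C :=
  - \sum_(T | [&& site_type T true false, ~~ small_sign T & same_ends S T])
      gen T (rcons y b).

Definition h2_pm (S : estate D) (y : seq (crossing D)) : C :=
  \sum_(T | site_type T true true && same_ends S T) gen T y.

Definition h2_gen (S : estate D) (x : seq (crossing D)) : C :=
  if site_type S false false then site_value h2_mm S [:: a; b] x
  else if site_type S true false && small_sign S then
    site_value h2_pm S [:: b] x
  else 0.

Definition h2 : C -> C := extend h2_gen.

Definition rho2_mp (S : estate D) (y : seq (crossing D)) : C :=
  gen S (rcons y a) + saddle_pm S y.

Definition rho2_pm (S : estate D) (y : seq (crossing D)) : C :=
  - saddle_mp S y - double_saddle S y.

Definition rho2_gen (S : estate D) (x : seq (crossing D)) : C :=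
  if site_type S false true then site_value rho2_mp S [:: a] x
  else if site_type S true false && small_sign S then
    site_value rho2_pm S [:: b] x
  else 0.

(* The submodule spanned by E_{-+}(p,q) (x) [xa] + E^-_{+-}(p:q,q:p) (x) [xb] *)
Definition subcomplex : {pred C} :=
  submod_gen (fun u => exists (S : estate D) (y : seq (crossing D)),
    [/\ site_type S false true, listing S (rcons y a)
      & u = gen S (rcons y a) + saddle_pm S y]).

HB.instance Definition _ := GRing.SubmodClosed.on subcomplex.

Definition subcomplex_type := {u : C | u \in subcomplex}.
HB.instance Definition _ := SubChoice.on subcomplex_type.
HB.instance Definition _ := [SubChoice_isSubLmodule of subcomplex_type by <:].

Definition inside (ma mb : bool) : seq (crossing D) :=
  (if ma then [::] else [:: a]) ++ (if mb then [::] else [:: b]).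

Lemma ab_neq : a != b. Proof. exact: site_neq. Qed.

Lemma inside_sub ma mb : {subset inside ma mb <= [:: a; b]}.
Proof.
move=> c; rewrite /inside mem_cat => /orP[]; [case: ma|case: mb] => //.
  by rewrite !inE => ->.
by rewrite !inE => ->; rewrite orbT.
Qed.

Lemma inside_uniq ma mb : uniq (inside ma mb).
Proof. by case: ma; case: mb => //=; rewrite inE ab_neq. Qed.

Lemma outer_inside S ma mb x : site_type S ma mb -> listing S x ->
  perm_eq (outer x ++ inside ma mb) x.
Proof.
move=> /andP[/eqP Sa /eqP Sb] Sx; have /andP[xu _] := Sx.
apply: uniq_perm => //.
  rewrite cat_uniq filter_uniq // inside_uniq andbT /=.
  apply/hasPn => c /inside_sub cab.
  by rewrite mem_filter cab.
move=> c; rewrite mem_cat mem_filter (listing_marker _ Sx) /inside mem_cat.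
rewrite !inE; have [->|ca] := eqVneq c a.
  by rewrite Sa; case: (ma); rewrite ?inE ?eqxx //=; case: (mb);
    rewrite ?inE ?(negPf ab_neq).
have [->|cb] := eqVneq c b.
  rewrite Sb; case: (mb); rewrite ?inE ?eqxx ?orbT //=; case: (ma) => //.
  by rewrite inE eq_sym (negPf ab_neq).
by case: (ma); case: (mb); rewrite /= ?inE ?(negPf ca) ?(negPf cb) ?orbF.
Qed.

Lemma listing_outer S ma mb x : site_type S ma mb -> listing S x ->
  listing S (outer x ++ inside ma mb).
Proof.
move=> St Sx; have Px := outer_inside St Sx; move: (Sx).
rewrite /listing (perm_uniq Px) => /andP[-> /forallP Sc]; apply/forallP => c.
by rewrite (perm_mem Px).
Qed.

Lemma outer_cat S y ma mb : site_type S ma mb ->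
  listing S (y ++ inside ma mb) -> outer (y ++ inside ma mb) = y.
Proof.
move=> /andP[/eqP Sa /eqP Sb] Sx; have /andP[] := Sx.
rewrite cat_uniq => /and3P[_ /hasPn yi _] _; rewrite /outer filter_cat.
have -> : [seq c <- inside ma mb | c \notin [:: a; b]] = [::].
  apply/eqP; rewrite -[_ == _]negbK -has_filter; apply/negP => /hasP[c].
  by move=> /inside_sub ->.
rewrite cats0; apply/all_filterP/allP => c cy; apply/negP => cab.
have : c \in y ++ inside ma mb by rewrite mem_cat cy.
have ci : c \notin inside ma mb by apply/negP => /yi /negP.
rewrite (listing_marker _ Sx); move: cab ci; rewrite !inE /inside.
by case/orP=> /eqP->; rewrite ?Sa ?Sb mem_cat; [case: (ma)|case: (mb)];
  rewrite ?inE ?eqxx ?orbT.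
Qed.

Definition outer_compatible f := forall (S : estate D) y
  (r : {perm crossing D}), perm_on [set c in y] r ->
  {in [:: a; b], forall c, r c = c} ->
  f S [seq r c | c <- y] = (-1) ^+ r *: f S y :> C.

Lemma site_value_perm f S ma mb x (s : {perm crossing D}) :
  outer_compatible f -> site_type S ma mb -> listing S x ->
  perm_on [set c in x] s ->
  site_value f S (inside ma mb) [seq s c | c <- x]
    = (-1) ^+ s *: site_value f S (inside ma mb) x.
Proof.
move=> fP St Sx xs; have Px := outer_inside St Sx; have /andP[xu _] := Sx.
have [r yr Er] : exists2 r : {perm crossing D},
    perm_on [set c in outer x] r & outer [seq s c | c <- x] = [seq r c | c <- outer x].
  apply: perm_signP; first exact: filter_uniq.
  apply: uniq_perm => [||c]; try exact: filter_uniq.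
    by rewrite filter_uniq // map_inj_uniq //; exact: perm_inj.
  by rewrite !mem_filter perm_on_mem.
have rab : {in [:: a; b], forall c, r c = c}.
  by move=> c cab; apply: (perm_on_notin yr); rewrite mem_filter cab.
have [t xt Et] := perm_signP (etrans (perm_uniq Px) xu) Px.
have Dt : perm_sign (outer x ++ inside ma mb) x = (-1) ^+ t.
  by rewrite -(perm_signE xt) -Et.
rewrite /site_value Er (fP S (outer x) r yr rab) Dt.
have zr : perm_on [set c in outer x ++ inside ma mb] r.
  by apply: perm_on_sub yr => c cx; rewrite mem_cat cx.
have Ez : [seq r c | c <- outer x] ++ inside ma mb
    = [seq r c | c <- outer x ++ inside ma mb].
  rewrite map_cat; congr cat; rewrite -[LHS]map_id; apply/eq_in_map => c.
  by move=> /inside_sub/rab.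
have -> : [seq s c | c <- x]
    = [seq (r^-1 * t * s)%g c | c <- [seq r c | c <- outer x ++ inside ma mb]].
  rewrite -map_comp [in LHS]Et -map_comp; apply: eq_map => c /=.
  by rewrite !permM permK.
rewrite Ez perm_signE; last first.
  have -> : [set c in [seq r c | c <- outer x ++ inside ma mb]]
      = [set c in outer x ++ inside ma mb].
    by apply/setP => c; rewrite !inE perm_on_mem.
  apply: perm_onM; first by apply: perm_onM => //; exact: perm_onV.
  by apply: perm_on_sub xs => c; rewrite (perm_mem Px).
rewrite !scalerA !odd_permM odd_permV -!signr_addb.
by case: (odd_perm r); case: (odd_perm s); case: (odd_perm t).
Qed.

Lemma site_value_cat f S ma mb y : site_type S ma mb ->
  listing S (y ++ inside ma mb) ->
  site_value f S (inside ma mb) (y ++ inside ma mb) = f S y.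
Proof.
move=> St Sx; rewrite /site_value (outer_cat St Sx) -{2}[y ++ _]map_id.
have -> : [seq c | c <- y ++ inside ma mb]
    = [seq (1%g : {perm crossing D}) c | c <- y ++ inside ma mb].
  by apply: eq_map => c; rewrite perm1.
by rewrite perm_signE ?perm_on1 // odd_perm1 scale1r.
Qed.

Lemma rcons_perm y c (r : {perm crossing D}) : perm_on [set c in y] r ->
  r c = c -> forall S, gen S (rcons [seq r d | d <- y] c)
    = (-1) ^+ r *: gen S (rcons y c).
Proof.
move=> yr rc S; rewrite -{1}rc -map_rcons gen_perm //.
by apply: perm_on_sub yr => d dy; rewrite mem_rcons inE dy orbT.
Qed.

Lemma fix_a (r : {perm crossing D}) :
  {in [:: a; b], forall c, r c = c} -> r a = a.
Proof. by apply; rewrite !inE eqxx. Qed.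

Lemma fix_b (r : {perm crossing D}) :
  {in [:: a; b], forall c, r c = c} -> r b = b.
Proof. by apply; rewrite !inE eqxx orbT. Qed.

Lemma saddle_pm_compatible : outer_compatible saddle_pm.
Proof.
move=> S y r yr rab; rewrite /saddle_pm scaler_sumr; apply: eq_bigr => T _.
by rewrite (rcons_perm yr (fix_b rab)) !scalerA mulrC.
Qed.

Lemma saddle_mp_compatible : outer_compatible saddle_mp.
Proof.
move=> S y r yr rab; rewrite /saddle_mp scaler_sumr; apply: eq_bigr => T _.
by rewrite (rcons_perm yr (fix_a rab)) !scalerA mulrC.
Qed.

Lemma double_saddle_compatible : outer_compatible double_saddle.
Proof.
move=> S y r yr rab; rewrite /double_saddle scaler_sumr; apply: eq_bigr => T _.
by rewrite (saddle_pm_compatible _ yr rab) !scalerA mulrC.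
Qed.

Lemma h2_mm_compatible : outer_compatible h2_mm.
Proof.
move=> S y r yr rab; rewrite /h2_mm scalerN scaler_sumr; congr (- _).
by apply: eq_bigr => T _; rewrite (rcons_perm yr (fix_b rab)).
Qed.

Lemma h2_pm_compatible : outer_compatible h2_pm.
Proof.
move=> S y r yr rab; rewrite /h2_pm scaler_sumr.
by apply: eq_bigr => T _; rewrite (gen_perm _ yr).
Qed.

Lemma rho2_mp_compatible : outer_compatible rho2_mp.
Proof.
move=> S y r yr rab; rewrite /rho2_mp scalerDr.
by rewrite (saddle_pm_compatible _ yr rab) (rcons_perm yr (fix_a rab)).
Qed.

Lemma rho2_pm_compatible : outer_compatible rho2_pm.
Proof.
move=> S y r yr rab; rewrite /rho2_pm scalerBr scalerN.
by rewrite (saddle_mp_compatible _ yr rab) (double_saddle_compatible _ yr rab).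
Qed.

Lemma h2_compatible : sign_compatible h2_gen.
Proof.
move=> S x s Sx xs; rewrite /h2_gen.
have [St|_] := boolP (site_type S false false).
  exact: (site_value_perm h2_mm_compatible St Sx xs).
have [/andP[St _]|_] := boolP (site_type S true false && small_sign S).
  exact: (site_value_perm h2_pm_compatible St Sx xs).
by rewrite scaler0.
Qed.

Lemma rho2_compatible : sign_compatible rho2_gen.
Proof.
move=> S x s Sx xs; rewrite /rho2_gen.
have [St|_] := boolP (site_type S false true).
  exact: (site_value_perm rho2_mp_compatible St Sx xs).
have [/andP[St _]|_] := boolP (site_type S true false && small_sign S).
  exact: (site_value_perm rho2_pm_compatible St Sx xs).
by rewrite scaler0.
Qed.

HB.instance Definition _ := GRing.isLinear.Build Zst C C _ h2
  (extend_linear h2_compatible).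

Lemma h2_mmE S y : site_type S false false -> listing S (y ++ [:: a; b]) ->
  h2 (gen S (y ++ [:: a; b])) =
  - \sum_(T | [&& site_type T true false, ~~ small_sign T & same_ends S T])
      gen T (rcons y b).
Proof.
move=> St Sx; rewrite /h2 (extend_gen h2_compatible) // /h2_gen St.
exact: (site_value_cat h2_mm St Sx).
Qed.

Lemma h2_pmE S y : site_type S true false -> small_sign S ->
  listing S (rcons y b) ->
  h2 (gen S (rcons y b)) =
  \sum_(T | site_type T true true && same_ends S T) gen T y.
Proof.
rewrite -cats1 => St Ss Sx; rewrite /h2 (extend_gen h2_compatible) // /h2_gen.
rewrite ifF; last by apply/negP; case/andP: St => /eqP Sa _ /andP[]; rewrite Sa.
by rewrite St Ss; apply: (site_value_cat h2_pm St Sx).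
Qed.

Lemma h2_0 S x : ~~ site_type S false false ->
  ~~ (site_type S true false && small_sign S) -> listing S x ->
  h2 (gen S x) = 0.
Proof.
move=> /negPf S1 /negPf S2 Sx.
by rewrite /h2 (extend_gen h2_compatible) // /h2_gen S1 S2.
Qed.

Lemma site_saddle_listing S T y : site_type S true false ->
  site_type T false true -> listing S (y ++ [:: b]) ->
  site_saddle S T != 0 -> listing T (rcons y a).
Proof.
rewrite /site_saddle /saddle; case: ifP; last by rewrite eqxx.
case/andP=> /forallP ST _ /andP[/eqP Sa /eqP Sb] /andP[/eqP Ta /eqP Tb] Sx _.
have /andP[] := Sx; rewrite cat_uniq /= orbF andbT => /andP[yu yb] _.
have ym c : c != b -> (c \in y) = ~~ marker S c.
  by move=> cb; rewrite -(listing_marker _ Sx) mem_cat inE (negPf cb) orbF.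
apply/andP; split; first by rewrite rcons_uniq ym ?ab_neq // Sa.
apply/forallP => c; rewrite mem_rcons inE.
have [->|ca] := eqVneq c a; first by rewrite Ta.
have [->|cb] := eqVneq c b; first by rewrite Tb (negPf yb).
by move: (ST c); rewrite !inE (negPf ca) (negPf cb) /= => /eqP ->; rewrite ym.
Qed.

Lemma rho2_gen_mem S x : listing S x -> rho2_gen S x \in subcomplex.
Proof.
move=> Sx; rewrite /rho2_gen; case: ifP => [St|_].
  apply: rpredZ; apply: submod_gen_mem; exists S, (outer x); split=> //.
  rewrite -cats1; exact: listing_outer St Sx.
case: ifP => [/andP[St _]|_]; last exact: rpred0.
apply: rpredZ; set y := outer x.
have Sy : listing S (y ++ [:: b]) := listing_outer St Sx.
rewrite /rho2_pm /saddle_mp /double_saddle -opprD -big_split /=.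
rewrite rpredN; apply: rpred_sum => T Tt; rewrite -scalerDr.
have [->|ST] := eqVneq (site_saddle S T) 0; first by rewrite scale0r rpred0.
apply: rpredZ; apply: submod_gen_mem; exists T, y; split=> //.
exact: site_saddle_listing ST.
Qed.

Lemma rho2_subproof v : extend rho2_gen v \in subcomplex.
Proof.
apply: rpred_sum => -[[S x] Sx] _; apply: rpredZ; exact: rho2_gen_mem Sx.
Qed.

Definition rho2 (v : C) : subcomplex_type :=
  exist (fun u => u \in subcomplex) (extend rho2_gen v) (rho2_subproof v).

Lemma rho2_linear : linear rho2.
Proof.
by move=> k u v; apply: val_inj; rewrite !linearP /=; apply: (extend_linear rho2_compatible).
Qed.

HB.instance Definition _ := GRing.isLinear.Build Zst C subcomplex_type _ rho2
  rho2_linear.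

Lemma rho2_mpE S y : site_type S false true -> listing S (rcons y a) ->
  val (rho2 (gen S (rcons y a))) = gen S (rcons y a) + saddle_pm S y.
Proof.
rewrite -cats1 => St Sx.
rewrite /= (extend_gen rho2_compatible) // /rho2_gen St.
transitivity (rho2_mp S y); last by rewrite /rho2_mp cats1.
exact: (site_value_cat rho2_mp St Sx).
Qed.

Lemma rho2_pmE S y : site_type S true false -> small_sign S ->
  listing S (rcons y b) ->
  val (rho2 (gen S (rcons y b))) = - saddle_mp S y - double_saddle S y.
Proof.
rewrite -cats1 => St Ss Sx.
rewrite /= (extend_gen rho2_compatible) // /rho2_gen.
rewrite ifF; last by apply/negP; case/andP: St => /eqP Sa _ /andP[]; rewrite Sa.
by rewrite St Ss; apply: (site_value_cat rho2_pm St Sx).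
Qed.

Lemma rho2_0 S x : ~~ site_type S false true ->
  ~~ (site_type S true false && small_sign S) -> listing S x ->
  val (rho2 (gen S x)) = 0.
Proof.
move=> /negPf S1 /negPf S2 Sx.
by rewrite /= (extend_gen rho2_compatible) // /rho2_gen S1 S2.
Qed.

Definition incl (v : subcomplex_type) : C := val v.

End Site.

(* Main.v *)
(* On a generator the identity is a computation inside the disk.  The terms
   of the crossings outside cancel, since a saddle there has the same coefficients for
   any two states that differ only by a horizontal smoothing of the disk.  What
   remains at [a] and [b] is the counit law for small sign +, the unit law for
   small sign -, and, for E^+_{+-}, the Frobenius identity expressing Delta o m and
   m o Delta through one split and one merge with the small circle.  That a saddle
   at the disk always merges or splits circles, and never rewires one circle into
   another, is where planarity is used: Euler's formula makes the diagram
   checkerboard colourable, by a rank count over F_2. *)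
Require Import Defs.
From mathcomp.classical Require Import boolp.
From mathcomp.multinomials Require Import mpoly.
From mathcomp Require Import all_boot all_order all_algebra all_fingroup.
From mathcomp Require Import zify.
Import GRing.Theory.
Local Open Scope ring_scope.

Set Implicit Arguments.
Unset Strict Implicit.
Unset Printing Implicit Defensive.

(** * Checkerboard colouring *)

(** The types [++], [+-] and [--] join the four ends of the disk in the same way, so their states
    have the same outer circles and correspond to each other by [resmooth]. The type [-+] joins the
    ends differently; it is reached only through [saddle_coef], a coefficient that depends on the
    two outer arcs alone and not on the crossing at which the saddle is made. The sign behind the
    cancellation outside the disk: [delta] appends the new crossing at the end of the list, while
    [h2] acts on the site crossings at the end. Moving an outer crossing in front of the site
    crossings before [h2], and back behind them after it, takes an odd number of transpositions,
    since [h2] removes exactly one site crossing. Hence the outer terms of [delta \o h2] and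
    [h2 \o delta] are opposite. For [E^+_{+-}] the double saddle in [rho2] is what must be left
    over: the states with small sign [-] split off from [E_{++}(p,q)] at [b], together with the
    image under [h2] of [E_{--}(m(p:+), q)]. *)

Section ClassMatrix.
Variables (F : fieldType) (T : finType).

(** The rows are the indicator vectors of the classes of [r], indexed by their roots. *)
Definition class_mx (r : rel T) : 'M[F]_(n_comp r {: T}, #|T|) :=
  \matrix_(i, j) (fingraph.root r (enum_val j) == enum_val i)%:R.

(** Row vectors are read as functions on [T]; right multiplication by this matrix is precomposition
    with [g]. *)
Definition fun_mx (g : T -> T) : 'M[F]_#|T| :=
  \matrix_(i, j) (enum_val i == g (enum_val j))%:R.

Lemma mul_fun_mx m (A : 'M[F]_(m, #|T|)) g i j :
  (A *m fun_mx g) i j = A i (enum_rank (g (enum_val j))).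
Proof.
rewrite mxE (bigD1 (enum_rank (g (enum_val j)))) //= !mxE enum_rankK eqxx mulr1.
rewrite big1 ?addr0 // => k kj; rewrite mxE; case: eqP => [e|]; last by rewrite mulr0.
by case/eqP: kj; rewrite -e enum_valK.
Qed.

Lemma fun_mxM g h : fun_mx g *m fun_mx h = fun_mx (g \o h).
Proof. by apply/matrixP => i j; rewrite mul_fun_mx !mxE enum_rankK. Qed.

Lemma fun_mx_id g : g =1 id -> fun_mx g = 1%:M.
Proof.
by move=> gE; apply/matrixP => i j; rewrite !mxE gE (inj_eq enum_val_inj).
Qed.

Lemma fun_mx_tr g h : cancel g h -> cancel h g -> (fun_mx g)^T = fun_mx h.
Proof. by move=> gK hK; apply/matrixP => i j; rewrite !mxE -(can2_eq gK hK) eq_sym. Qed.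

Lemma invariant_sub_class_mx r (v : 'rV[F]_#|T|) : connect_sym r ->
  (forall x y, r x y -> v 0 (enum_rank x) = v 0 (enum_rank y)) ->
  (v <= class_mx r)%MS.
Proof.
move=> sym vP; have vE x y : connect r x y -> v 0 (enum_rank x) = v 0 (enum_rank y).
  case/connectP => p; elim: p x => [|z p IHp] x /=; first by move=> _ ->.
  by case/andP=> /vP-> /IHp; apply.
(* The coefficient of a class is the value of [v] at its root. *)
apply/submxP; exists (\row_i v 0 (enum_rank (enum_val i))).
apply/rowP => j; rewrite mxE.
have rj : fingraph.root r (enum_val j) \in [predI roots r & {: T}].
  by rewrite inE /= andbT; exact: roots_root.
rewrite (bigD1 (enum_rank_in rj (fingraph.root r (enum_val j)))) //= big1.
  rewrite addr0 !mxE enum_rankK_in // eqxx mulr1.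
  by rewrite -[in LHS](enum_valK j); apply: vE; exact: connect_root.
move=> i /eqP ij; rewrite !mxE; case: eqP => [e|]; last by rewrite mulr0.
by case: ij; apply: enum_val_inj; rewrite enum_rankK_in.
Qed.

(** The columns at the roots form an identity matrix, so selecting them is a right inverse. *)
Lemma class_mx_free r : connect_sym r -> row_free (class_mx r).
Proof.
move=> sym; apply/row_freeP; exists (\matrix_(j, i) (enum_val j == enum_val i)%:R).
apply/matrixP => i j; rewrite mxE (bigD1 (enum_rank (enum_val j))) //= big1.
  rewrite addr0 !mxE !enum_rankK eqxx mulr1.
  have /andP[/= /eqP-> _] := enum_valP j.
  by rewrite (inj_eq enum_val_inj) eq_sym.
move=> k kj; rewrite !mxE; case: (enum_val k =P _) => [e|]; last by rewrite mulr0.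
by case/eqP: kj; rewrite -e enum_valK.
Qed.

Lemma class_mx_fun g : injective g -> class_mx (frel g) *m fun_mx g = class_mx (frel g).
Proof.
move=> gI; apply/matrixP => i j; rewrite mul_fun_mx !mxE enum_rankK.
suff /eqP-> : fingraph.root (frel g) (g (enum_val j)) == fingraph.root (frel g) (enum_val j) by [].
rewrite root_connect; last exact: fconnect_sym.
by rewrite fconnect_sym // fconnect1.
Qed.

End ClassMatrix.

Lemma turnD (C : Type) k l (d : darts C) : turn k (turn l d) = turn (l + k) d.
Proof. by rewrite /turn /= addrA. Qed.

Lemma turn0 (C : Type) (d : darts C) : turn 0 d = d.
Proof. by case: d => c k; rewrite /turn /= addr0. Qed.

Lemma turnK (C : Type) k : cancel (@turn C k) (turn (- k)).
Proof. by move=> d; rewrite turnD addrN turn0. Qed.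

Lemma turnNK (C : Type) k : cancel (@turn C (- k)) (turn k).
Proof. by move=> d; rewrite turnD addNr turn0. Qed.

Lemma odd_add1 (k : 'Z_4) : odd (k + 1 : 'Z_4)%R = ~~ odd k.
Proof. by case: k => [[|[|[|[|k]]]] Hk]. Qed.

Lemma odd_turn1 (C : Type) (d : darts C) : odd (turn 1 d).2 = ~~ odd d.2.
Proof. by rewrite /turn odd_add1. Qed.

(** A step along [t] is undone by going round its finite orbit, so connectivity is symmetric
    although the relation itself need not be. *)
Lemma pred2_connect_sym (T : finType) (e t : T -> T) : involutive e -> injective t ->
  connect_sym (fun x y => (y == e x) || (y == t x)).
Proof.
move=> eK tI; set r := (fun _ => _); have step x y : r x y -> connect r y x.
  case/orP=> /eqP->; first by apply: connect1; rewrite /r eK eqxx.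
  have : fconnect t (t x) x by rewrite fconnect_sym // fconnect1.
  apply: connect_sub => u v /eqP<-; apply: connect1; by rewrite /r eqxx orbT.
have rev x y : connect r x y -> connect r y x.
  case/connectP => p; elim: p x => [|z p IHp] x /=; first by move=> _ ->.
  by case/andP=> xz zp lp; apply: connect_trans (IHp z zp lp) (step _ _ xz).
by move=> x y; apply/idP/idP; apply: rev.
Qed.

Lemma F2_addrr (x : 'F_2) : x + x = 0.
Proof. by case: x => [[|[|k]] Hk] //; apply/val_inj. Qed.

Lemma mx_F2_addrr m n (A : 'M['F_2]_(m, n)) : A + A = 0.
Proof. by apply/matrixP => i j; rewrite !mxE F2_addrr. Qed.

(* Over F_2, the rows of [A] are the functions [x |-> (v x + v (e x), v x + v (t x))],
   and those of [U] the orbits of [e], [t] and [t \o e], embedded so that they are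
   orthogonal to [A].  The count of orbits says that [U] has the rank of the whole
   orthogonal of [A]; since the all-one vector is orthogonal to [U], it is spanned
   by [A], and this gives the colouring. *)
Lemma two_colouring (T : finType) (e t : T -> T) (p : T -> bool)
    (r := fun x y => (y == e x) || (y == t x)) :
  involutive e -> (forall x, e x != x) -> injective t ->
  (forall x, p (t x) = ~~ p x) ->
  (fcard e {: T} + fcard t {: T} + fcard (t \o e) {: T}
     = #|{: T}| + 2 * n_comp r {: T})%N ->
  exists col : T -> bool,
    (forall x, col (e x) = ~~ col x) /\ (forall x, col (t x) = ~~ col x).
Proof.
move=> eK e_neq tI pt euler.
have eI : injective e := inv_inj eK.
have fI : injective (t \o e) by apply: inj_comp.
have symr : connect_sym r := pred2_connect_sym eK tI.
pose F := 'F_2.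
pose Pe := fun_mx F e; pose Pt := fun_mx F t.
pose Be := class_mx F (frel e); pose Bt := class_mx F (frel t).
pose Bf := class_mx F (frel (t \o e)); pose Bc := class_mx F r.
have PeK : Pe *m Pe = 1%:M by rewrite fun_mxM; apply: fun_mx_id.
have PeT : Pe^T = Pe by apply: fun_mx_tr.
have PtK : Pt *m Pt^T = 1%:M.
  rewrite (fun_mx_tr F (finv_f tI) (f_finv tI)) fun_mxM.
  by apply: fun_mx_id => x /=; rewrite f_finv.
have BeP : Be *m Pe = Be by apply: class_mx_fun.
have BtP : Bt *m Pt = Bt by apply: class_mx_fun.
have BfP : Bf *m Pt *m Pe = Bf by rewrite -mulmxA fun_mxM; apply: class_mx_fun.
have BfPt : Bf *m Pt = Bf *m Pe by rewrite -[in RHS]BfP -!mulmxA PeK mulmx1.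
have BtPT : Bt *m Pt^T = Bt by rewrite -{1}BtP -mulmxA PtK mulmx1.
pose A := row_mx (1%:M + Pe) (1%:M + Pt).
pose U := col_mx (row_mx Be 0) (col_mx (row_mx 0 Bt) (row_mx Bf (Bf *m Pe))).
have AU : U *m A^T = 0.
  rewrite /U /A tr_row_mx !mul_col_mx !mul_row_col !mul0mx addr0 add0r.
  rewrite ![(_ + _)^T]linearD /= !trmx1 PeT !mulmxDr !mulmx1 BeP mx_F2_addrr BtPT mx_F2_addrr.
  rewrite -BfPt -mulmxA PtK mulmx1.
  by rewrite [X in _ + X]addrC mx_F2_addrr !col_mx0.
have ones (g : T -> T) (q : T -> bool) : (forall x, q (g x) = ~~ q x) ->
    exists o : 'rV[F]_#|T|, const_mx 1 = o + o *m fun_mx F g.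
  move=> qg; exists (\row_i (q (enum_val i))%:R).
  apply/rowP => i; rewrite !(mul_fun_mx, mxE) enum_rankK qg.
  by case: (q _); apply/val_inj.
have [oe oeE] : exists o : 'rV[F]_#|T|, const_mx 1 = o + o *m Pe.
  (* As [e] has no fixed point, comparing ranks selects one element of each pair formed by [x] and
     [e x]. *)
  apply: (ones _ (fun x => enum_rank x < enum_rank (e x))%N) => x.
  rewrite eK -leqNgt ltn_neqAle andb_idl // => _.
  by apply: contra (e_neq x) => /eqP/val_inj/enum_rank_inj/eqP.
have [ot otE] : exists o : 'rV[F]_#|T|, const_mx 1 = o + o *m Pt by exact: ones pt.
pose j1 : 'rV[F]_#|T| := const_mx 1.
have j1Pe : Pe *m j1^T = j1^T.
  apply: (can_inj (@trmxK _ _ _)); rewrite trmx_mul trmxK PeT.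
  by apply/rowP => i; rewrite mul_fun_mx !mxE.
(* Orbits of [e] and [t] pair to zero with the constant vector because it has the form
   [o + o *m fun_mx F g] for both; an orbit of [t \o e] pairs equally with the two halves, and these
   contributions cancel modulo 2. *)
have U1 : U *m (row_mx j1 j1)^T = 0.
  rewrite /U tr_row_mx !mul_col_mx !mul_row_col !mul0mx addr0 add0r.
  rewrite -[Bf *m Pe *m _]mulmxA j1Pe mx_F2_addrr /j1 {1}oeE otE.
  rewrite ![(_ + _)^T]linearD /= !trmx_mul !mulmxDr PeT !mulmxA BeP BtPT.
  by rewrite !mx_F2_addrr !col_mx0.
(* The kernel of [A] consists of the functions invariant under [e] and [t], that is, constant on
   components. *)
have rA : (#|T| - n_comp r {: T} <= \rank A)%N.
  have : (\rank (kermx A) <= n_comp r {: T})%N.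
    apply: leq_trans (rank_leq_row Bc); apply: mxrankS; apply/rV_subP => v.
    rewrite (sameP sub_kermxP eqP) mul_mx_row -[0]row_mx0 => /eqP/eq_row_mx [].
    rewrite !mulmxDr !mulmx1 => /rowP ve /rowP vt.
    have F2_eq (x y : F) : x + y = 0 -> x = y.
      by move=> xy; rewrite -[x]addr0 -(F2_addrr y) addrA xy add0r.
    apply: invariant_sub_class_mx => // x y /orP[] /eqP->.
      by apply: F2_eq; move: (ve (enum_rank x)); rewrite mxE mul_fun_mx enum_rankK mxE.
    by apply: F2_eq; move: (vt (enum_rank x)); rewrite mxE mul_fun_mx enum_rankK mxE.
  by rewrite mxrank_ker leq_subLR addnC -leq_subLR.
(* A relation between the rows of [U] has three parts, and [Mc] extracts the function given by the
   part on the orbits of [t \o e]. By the relation this function is invariant under [e] and then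
   under [t], and it determines the relation because the indicators of orbits are independent. So
   the relations have dimension at most the number of components. *)
pose Mc : 'M[F]_(_, #|T|) := col_mx (0 : 'M_(n_comp (frel e) {: T}, _))
   (col_mx (0 : 'M_(n_comp (frel t) {: T}, _)) Bf).
have rU : (\rank (kermx U) <= n_comp r {: T})%N.
  have UP m (v : 'M_(m, _)) : (v <= kermx U)%MS ->
      [/\ lsubmx v *m Be = rsubmx (rsubmx v) *m Bf,
          lsubmx (rsubmx v) *m Bt = rsubmx (rsubmx v) *m Bf *m Pe
        & v *m Mc = rsubmx (rsubmx v) *m Bf].
    have vE : v = row_mx (lsubmx v) (row_mx (lsubmx (rsubmx v)) (rsubmx (rsubmx v))).
      by rewrite !hsubmxK.
    move: (lsubmx v) (lsubmx (rsubmx v)) (rsubmx (rsubmx v)) vE => v1 v2 v3 ->.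
    rewrite (sameP sub_kermxP eqP) => /eqP.
    rewrite !mul_row_col !mul_mx_row !mulmx0 !add_row_mx !add0r.
    rewrite -[0]row_mx0 => /eq_row_mx[e1 e2]; split=> //.
      by rewrite -[RHS]add0r -e1 -addrA mx_F2_addrr addr0.
    by rewrite -[RHS]add0r -mulmxA -e2 -addrA mx_F2_addrr addr0.
  rewrite -(mxrank_mul_ker _ Mc).
  have -> : \rank (kermx U :&: kermx Mc)%MS = 0%N.
    apply/eqP; rewrite mxrank_eq0 -submx0; apply/rV_subP => v.
    rewrite sub_capmx => /andP[/UP[ve vt vM]]; rewrite (sameP sub_kermxP eqP) vM.
    move=> /eqP vf; move: ve vt; rewrite vf mul0mx.
    have free0 (g : T -> T) m (w : 'M_(m, _)) : injective g ->
        w *m class_mx F (frel g) = 0 -> w = 0.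
      move=> gI /eqP; rewrite mulmx_free_eq0 => [/eqP //|].
      exact/class_mx_free/fconnect_sym.
    move=> /(free0 e 1%N _ eI) v1 /(free0 t 1%N _ tI) v2.
    rewrite submx0 -[v]hsubmxK -[X in row_mx _ X]hsubmxK v1 v2.
    by rewrite (free0 (t \o e) 1%N _ fI vf) !row_mx0.
  rewrite addn0; apply: leq_trans (rank_leq_row Bc); apply: mxrankS.
  apply/rV_subP => w /submxP[x ->]; rewrite mulmxA.
  have /UP[ve vt ->] := submxMl x (kermx U).
  apply: invariant_sub_class_mx => //.
  set v := x *m kermx U in ve vt *.
  have stepe y : (rsubmx (rsubmx v) *m Bf) 0 (enum_rank (e y))
      = (rsubmx (rsubmx v) *m Bf) 0 (enum_rank y).
    by rewrite -ve -{2}BeP mulmxA [in RHS]mul_fun_mx enum_rankK.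
  move=> y z /orP[] /eqP->; first by rewrite stepe.
  transitivity ((rsubmx (rsubmx v) *m Bf *m Pt) 0 (enum_rank y)).
    by rewrite -mulmxA BfPt mulmxA mul_fun_mx enum_rankK stepe.
  by rewrite mul_fun_mx enum_rankK.
have : (row_mx j1 j1 <= A)%MS.
  have AK : (A <= kermx U^T)%MS.
    by rewrite (sameP sub_kermxP eqP) -[A]trmxK -trmx_mul AU trmx0.
  (* With [n] elements and [k] components, [U] has [n + 2k] rows by [euler] and hence rank at least
     [n + k]; its orthogonal in dimension [2n] has dimension at most [n - k], which [rA] bounds by
     the rank of [A]. *)
  have AE : (kermx U^T <= A)%MS.
    rewrite -(geq_leqif (mxrank_leqif_sup AK)); apply: leq_trans rA.
    rewrite mxrank_ker mxrank_tr leq_subLR.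
    have nU : (#|T| + n_comp r {: T} <= \rank U)%N.
      move: rU; rewrite mxrank_ker; move: (\rank U) => u.
      by rewrite leq_subLR addnA euler mul2n -addnn addnA leq_add2r.
    by apply: leq_trans (leq_add nU (leqnn _)); rewrite -addnA leq_add2l -leq_subLR.
  by apply: submx_trans AE; rewrite (sameP sub_kermxP eqP) -[row_mx _ _]trmxK -trmx_mul U1 trmx0.
case/submxP => v; rewrite mul_mx_row => /eq_row_mx[ve vt].
have F2_neq (x y : 'F_2) : 1 = x + y -> (y == 0) = ~~ (x == 0).
  by case: x => [[|[|k]] Hk]; case: y => [[|[|l]] Hl].
exists (fun x => v 0 (enum_rank x) == 0); split=> x; apply: F2_neq.
  move/rowP/(_ (enum_rank x)): ve.
  by rewrite mulmxDr mulmx1 mxE [in RHS]mxE mul_fun_mx enum_rankK.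
move/rowP/(_ (enum_rank x)): vt.
by rewrite mulmxDr mulmx1 mxE [in RHS]mxE mul_fun_mx enum_rankK.
Qed.

(** The two changes of colour cancel along [turn 1 \o edge], so this is a colouring of the faces in
    which the two sides of an edge differ. *)
Lemma checkerboard (D : link_diagram) : exists col : dart D -> bool,
  (forall d, col (edge d) = ~~ col d) /\ (forall d, col (turn 1 d) = ~~ col d).
Proof.
apply: (@two_colouring _ _ _ (fun d : dart D => odd d.2)).
- exact: edgeK.
- exact: edge_neq.
- exact: can_inj (@turnK _ 1).
- by move=> d; rewrite odd_turn1.
- exact: edge_planar.
Qed.

(** Multiplication by a transposition raises or lowers the number of cycles by one according to
    whether [x] and [y] share a cycle. Applying this to [s] and to [tperm x y * s], from which a
    second multiplication leads back to [s], forces opposite answers. *)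
Lemma tperm_porbit (T : finType) (s : {perm T}) (x y : T) : x != y ->
  (y \in porbit (tperm x y * s)%g x) = (y \notin porbit s x).
Proof.
move=> xy; have P := @porbits_mul_tperm T.
have /= e1 := P s x y; have /= e2 := P (tperm x y * s)%g x y.
move: e1 e2; rewrite mulgA tperm2 mul1g xy /= ![y \in _]porbit_sym.
by case: (x \in porbit _ y); case: (x \in porbit _ y) => /=; lia.
Qed.

Lemma connect_homo (T U : finType) (e : rel T) (e' : rel U) (f : T -> U) :
  (forall x y, e x y -> connect e' (f x) (f y)) ->
  forall x y, connect e x y -> connect e' (f x) (f y).
Proof.
move=> fe x y /connectP[p]; elim: p x => [|z p IHp] x /=; first by move=> _ ->.
by case/andP=> /fe xz zp /(IHp _ zp); apply: connect_trans.
Qed.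

(** * State circles *)

Section Circles.
Variable D : link_diagram.
Implicit Types (m : {ffun crossing D -> bool}) (d : dart D) (c : crossing D).

Lemma odd_sub1 (k : 'Z_4) : odd (k - 1 : 'Z_4)%R = ~~ odd k.
Proof. by case: k => [[|[|[|[|k]]]] Hk]. Qed.

Lemma smoothK m : involutive (smooth m).
Proof.
move=> d; rewrite {2}/smooth; case: ifP => md; rewrite /smooth.
  by rewrite odd_turn1 addbN md turnK.
by rewrite /= odd_sub1 addbN md turnNK.
Qed.

Lemma smooth_crossing m d : (smooth m d).1 = d.1.
Proof. by rewrite /smooth; case: ifP. Qed.

Lemma smooth_agree m m' d : m' d.1 = m d.1 -> smooth m' d = smooth m d.
Proof. by rewrite /smooth => ->. Qed.

Lemma adjacent_sym m : symmetric (adjacent m).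
Proof.
case=> [d|i] [e|j] //=; rewrite ![e == _]eq_sym.
by rewrite (can2_eq (@edgeK D) (@edgeK D)) (can2_eq (smoothK m) (smoothK m)).
Qed.

Lemma same_circle_sym m : symmetric (same_circle m).
Proof. by apply: sym_connect_sym; exact: adjacent_sym. Qed.

Lemma same_circle_trans m : transitive (same_circle m).
Proof. exact: connect_trans. Qed.

Lemma same_circle_refl m u : same_circle m u u.
Proof. exact: connect0. Qed.

Lemma same_circle_edge m d : same_circle m (inl d) (inl (edge d)).
Proof. by apply: connect1; rewrite /= eqxx. Qed.

Lemma same_circle_smooth m d : same_circle m (inl d) (inl (smooth m d)).
Proof. by apply: connect1; rewrite /= eqxx orbT. Qed.

Lemma same_circleL m u v w : same_circle m u v -> same_circle m u w = same_circle m v w.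
Proof. by move=> uv; apply: same_connect uv w; exact: same_circle_sym. Qed.

Lemma same_circleR m u v w : same_circle m u v -> same_circle m w u = same_circle m w v.
Proof. by move=> uv; apply: same_connect_r uv w; exact: same_circle_sym. Qed.

(* [smooth] and [edge] both swap the two colours, so that on one colour class the
   circles are the cycles of [edge \o smooth], and the marker change multiplies
   this permutation by a transposition. *)
Lemma same_circle_flip m m' c : m' c = ~~ m c -> (forall x, x != c -> m' x = m x) ->
  same_circle m' (inl (c, 0)) (inl (c, 2)) = ~~ same_circle m (inl (c, 0)) (inl (c, 2)).
Proof.
move=> m'c m'E; have [col [col_edge col_turn]] := checkerboard D.
have col_turnN d : col (turn (-1) d) = ~~ col d.
  by rewrite -[in RHS](turnNK 1 d) col_turn negbK.
have col_smooth n d : col (smooth n d) = ~~ col d.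
  by rewrite /smooth; case: ifP => _; rewrite (col_turn, col_turnN).
pose k := col (c, 0).
have col2 : col (c, 2) = k.
  have -> : (c, 2) = turn 1 (turn 1 (c, 0)) :> dart D by rewrite turnD /turn /= add0r.
  by rewrite !col_turn negbK.
(* Being the identity on the other colour makes [psi] a permutation of all half-edges. *)
pose psi n d := if col d == k then edge (smooth n d) else d.
have psiI n : injective (psi n).
  move=> d e; rewrite /psi; case: eqP => dk; case: eqP => ek //.
  - by move/(can_inj (@edgeK D))/(can_inj (smoothK n)).
  - by move=> de; case: ek; rewrite -de col_edge col_smooth negbK.
  - by move=> de; case: dk; rewrite de col_edge col_smooth negbK.
have circleE n d e : col d = k -> col e = k ->
    same_circle n (inl d) (inl e) = (e \in porbit (perm (psiI n)) d).
  move=> dk ek; apply/idP/porbitP => [|[i ->]]; last first.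
    elim: i => [|i IHi]; first by rewrite expg0 perm1 same_circle_refl.
    apply: same_circle_trans IHi _; rewrite expgSr permM permE /psi.
    case: ifP => _; last exact: same_circle_refl.
    exact: same_circle_trans (same_circle_smooth n _) (same_circle_edge n _).
  (* A half-edge of the other colour is represented by the opposite end of its edge; crossingless
     components are adjacent to nothing, so any value serves there. *)
  pose f (u : strand D) := if u is inl x then if col x == k then x else edge x else d.
  suff H u v : same_circle n u v -> fconnect (perm (psiI n)) (f u) (f v).
    move/H; rewrite /f dk ek eqxx => /iter_findex <-.
    by exists (findex (perm (psiI n)) d e); rewrite permX.
  move: u v; apply: connect_homo => -[x|i] [y|j] //= /orP[] /eqP->.
    rewrite col_edge edgeK; case: (col x == k) / eqP => xk.
      by rewrite xk; case: (k) => /=; apply: connect0.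
    by have -> : ~~ col x == k by move: xk; case: (col x); case: (k).
  rewrite col_smooth; case: (col x == k) / eqP => xk.
    have -> : (~~ col x == k) = false by rewrite xk; case: (k).
    by rewrite -[X in fconnect _ _ X](_ : perm (psiI n) x = _) ?fconnect1 // permE /psi xk eqxx.
  have xk' : ~~ col x == k by move: xk; case: (col x); case: (k).
  rewrite xk' fconnect_sym; last exact: perm_inj.
  have -> : edge x = perm (psiI n) (smooth n x) by rewrite permE /psi col_smooth xk' smoothK.
  exact: fconnect1.
have neq02 : (c, 0) != (c, 2) :> dart D by rewrite xpair_eqE andbC.
rewrite !circleE // -tperm_porbit //.
have -> // : perm (psiI m') = (tperm (c, 0) (c, 2) * perm (psiI m))%g.
apply/permP => d; rewrite permM [LHS]permE [RHS]permE.
case: tpermP => [->|->|d0 d2]; rewrite /psi ?col2 ?eqxx.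
- by congr edge; rewrite /smooth /= m'c; case: (m c); congr (c, _); apply/val_inj.
- by congr edge; rewrite /smooth /= m'c; case: (m c); congr (c, _); apply/val_inj.
case: ifP => // dk; congr edge; apply: smooth_agree; apply: m'E.
apply: contraL dk; case: d d0 d2 => c' i /= d0 d2 /eqP cc; rewrite {}cc in d0 d2 *.
(* At [c] only the half-edges 0 and 2 have colour [k]: the odd ones are a quarter turn away from
   them. *)
have [oi|] := boolP (odd i); last first.
  by case: i d0 d2 => [[|[|[|[|i]]]] Hi] // d0 d2 _; [case: d0|case: d2]; congr (c, _); apply/val_inj.
suff -> : col (c, i) = ~~ k by case: (k).
have i1 : i = 1 \/ i = 1 + 2 by case: i oi {d0 d2} => [[|[|[|[|i]]]] Hi] // _; [left|right]; apply/val_inj.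
have -> : (c, i) = turn 1 (if i == 1 then (c, 0) else (c, 2)) :> dart D.
  by rewrite /turn; case: i1 => ->; congr (c, _); apply/val_inj.
by rewrite col_turn; case: ifP; rewrite ?col2.
Qed.

End Circles.

(** * State circles at the site *)

Section SiteCircles.
Variables (D : link_diagram) (X : R2_site D).
Local Notation a := (ne X).1.
Local Notation b := (se X).1.
Local Notation nw := (turn 1 (ne X)).
Local Notation sw := (turn 3 (se X)).
Local Notation la := (turn 2 (ne X)).
Local Notation ra := (turn 3 (ne X)).
Local Notation rb := (turn 1 (se X)).
Local Notation lb := (turn 2 (se X)).
Implicit Types (m : {ffun crossing D -> bool}) (d : dart D) (u v : strand D)
  (Y : {set crossing D}).

(** The base half-edges of the site may be 0 or 2. Only parity enters [smooth], so at both crossings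
    it can be computed relative to the base. *)
Lemma smooth_even m d k : ~~ odd d.2 ->
  smooth m (turn k d) = turn (if m d.1 (+) odd k then k + 1 else k - 1) d.
Proof.
move=> d0; have ek : odd (turn k d).2 = odd k.
  case: d d0 => c [[|[|[|[|j]]]] Hj] //; case: k => [[|[|[|[|k]]]] Hk] //.
by rewrite /smooth ek /=; case: ifP => _; rewrite turnD.
Qed.

Lemma dart_turn d d' : d.1 = d'.1 -> exists k, d = turn k d'.
Proof.
by case: d d' => c i [c' j] /= <-; exists (i - j); rewrite /turn /= addrC subrK.
Qed.

Lemma eq_turn d k l : (turn k d == turn l d) = (k == l).
Proof. by rewrite xpair_eqE eqxx (inj_eq (addrI _)). Qed.

Lemma Z4_cases (P : 'Z_4 -> Prop) : P 0 -> P 1 -> P 2 -> P 3 -> forall k, P k.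
Proof.
move=> P0 P1 P2 P3 [[|[|[|[|k]]]] Hk] //;
  [move: P0|move: P1|move: P2|move: P3]; congr P; exact/val_inj.
Qed.

Lemma Z4_succ_pred : ((0 + 1 = 1 :> 'Z_4) * (1 + 1 = 2 :> 'Z_4) * (2 + 1 = 3 :> 'Z_4)
  * (3 + 1 = 0 :> 'Z_4) * (0 - 1 = 3 :> 'Z_4) * (1 - 1 = 0 :> 'Z_4)
  * (2 - 1 = 1 :> 'Z_4) * (3 - 1 = 2 :> 'Z_4)).
Proof. by do ?split; apply/val_inj. Qed.

Lemma smooth_a m k :
  smooth m (turn k (ne X)) = turn (if m a (+) odd k then k + 1 else k - 1) (ne X).
Proof. by rewrite smooth_even // ne_under. Qed.

Lemma smooth_b m k :
  smooth m (turn k (se X)) = turn (if m b (+) odd k then k + 1 else k - 1) (se X).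
Proof. by rewrite smooth_even // se_under. Qed.

Lemma turn_a_b k l : turn k (ne X) == turn l (se X) = false.
Proof. by apply/negbTE; rewrite xpair_eqE negb_and site_neq. Qed.

Lemma inner_a k : inner X (inl (turn k (ne X))) = (k == 2) || (k == 3).
Proof.
rewrite /inner !inE !(inj_eq inl_inj) !eq_turn !turn_a_b.
by rewrite !orbF.
Qed.

Lemma inner_b k : inner X (inl (turn k (se X))) = (k == 1) || (k == 2).
Proof.
rewrite /inner !inE !(inj_eq inl_inj) !eq_turn.
by rewrite ![_ == turn _ (ne X)]eq_sym !turn_a_b.
Qed.

Lemma innerP u :
  inner X u -> [\/ u = inl la, u = inl ra, u = inl rb | u = inl lb].
Proof.
by rewrite /inner !inE => /or4P[] /eqP->;
  [constructor 1|constructor 2|constructor 3|constructor 4].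
Qed.

Lemma inner_crossing d : inner X (inl d) -> d.1 \in [set a; b].
Proof. by case/innerP=> -[->]; rewrite !inE eqxx ?orbT. Qed.

Lemma outside_ninner d : d.1 \notin [set a; b] -> inner X (inl d) = false.
Proof. by apply: contraNF; exact: inner_crossing. Qed.

Lemma edge_la : edge la = lb. Proof. exact: left_edge. Qed.
Lemma edge_ra : edge ra = rb. Proof. exact: right_edge. Qed.

Lemma inner_edge d : inner X (inl (edge d)) = inner X (inl d).
Proof.
suff H e : inner X (inl e) -> inner X (inl (edge e)).
  by apply/idP/idP => [/H|/H //]; rewrite edgeK.
case/innerP=> -[->].
- by rewrite edge_la inner_b.
- by rewrite edge_ra inner_b.
- by rewrite -edge_ra edgeK inner_a.
- by rewrite -edge_la edgeK inner_a.
Qed.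

(** The types [++], [+-] and [--], which join NE to NW and SE to SW. *)
Definition horizontal m := m a || ~~ m b.

Definition agree_outside m m' := forall c, c \notin [set a; b] -> m' c = m c.

Lemma agree_outside_sym m m' : agree_outside m m' -> agree_outside m' m.
Proof. by move=> mm c cX; rewrite mm. Qed.

Local Notation sc m u v := (same_circle m (inl u) (inl v)).

Lemma sc_la_lb m : sc m la lb.
Proof. by rewrite -edge_la same_circle_edge. Qed.

Lemma sc_ra_rb m : sc m ra rb.
Proof. by rewrite -edge_ra same_circle_edge. Qed.

Lemma sc_a m (k l : 'Z_4) : (if m a (+) odd k then k + 1 else k - 1) = l ->
  sc m (turn k (ne X)) (turn l (ne X)).
Proof. by move=> <-; rewrite -smooth_a same_circle_smooth. Qed.

Lemma sc_b m (k l : 'Z_4) : (if m b (+) odd k then k + 1 else k - 1) = l ->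
  sc m (turn k (se X)) (turn l (se X)).
Proof. by move=> <-; rewrite -smooth_b same_circle_smooth. Qed.

Lemma turn0_ne : ne X = turn 0 (ne X). Proof. by rewrite turn0. Qed.
Lemma turn0_se : se X = turn 0 (se X). Proof. by rewrite turn0. Qed.

Lemma sc_a_pos m : m a -> sc m (ne X) nw /\ sc m la ra.
Proof.
move=> ma; split; first by rewrite {1}turn0_ne; apply: sc_a; rewrite ma; apply/val_inj.
by apply: sc_a; rewrite ma; apply/val_inj.
Qed.

Lemma sc_a_neg m : m a = false -> sc m (ne X) ra /\ sc m nw la.
Proof.
move=> ma; split; first by rewrite {1}turn0_ne; apply: sc_a; rewrite ma; apply/val_inj.
by apply: sc_a; rewrite ma; apply/val_inj.
Qed.

Lemma sc_b_pos m : m b -> sc m (se X) rb /\ sc m lb sw.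
Proof.
move=> mb; split; first by rewrite {1}turn0_se; apply: sc_b; rewrite mb; apply/val_inj.
by apply: sc_b; rewrite mb; apply/val_inj.
Qed.

Lemma sc_b_neg m : m b = false -> sc m (se X) sw /\ sc m rb lb.
Proof.
move=> mb; split; first by rewrite {1}turn0_se; apply: sc_b; rewrite mb; apply/val_inj.
by apply: sc_b; rewrite mb; apply/val_inj.
Qed.

(** For [++] the arc from SE to SW runs through both edges of the bigon and turns at [a]; for [--]
    the arc from NE to NW does so and turns at [b]; for [+-] both arcs turn at once and leave the
    bigon as the small circle. *)
Lemma horizontal_ends m : horizontal m -> sc m (ne X) nw /\ sc m (se X) sw.
Proof.
rewrite /horizontal; case: (boolP (m a)) => [ma _|/negPf ma /negPf mb].
  have [ma1 ma2] := sc_a_pos ma; split=> //.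
  case: (boolP (m b)) => [mb|/negPf mb]; last by have [] := sc_b_neg mb.
  have [mb1 mb2] := sc_b_pos mb.
  apply: same_circle_trans mb1 _; rewrite -(same_circleL _ (sc_ra_rb m)).
  by rewrite -(same_circleL _ ma2) (same_circleL _ (sc_la_lb m)).
have [mb1 mb2] := sc_b_neg mb; have [ma1 ma2] := sc_a_neg ma; split=> //.
rewrite (same_circleL _ ma1) (same_circleR _ ma2) (same_circleL _ (sc_ra_rb m)).
by rewrite (same_circleR _ (sc_la_lb m)).
Qed.

(** This and the next three lemmas locate the inner half-edges: on the lower arc for [++], on the
    upper arc for [--], on the small circle for [+-], and shared between the left and right arcs for
    [-+]. *)
Lemma circle_pp m u : m a -> m b -> inner X u -> same_circle m u (inl (se X)).
Proof.
move=> ma mb; have [_ ma2] := sc_a_pos ma; have [mb1 mb2] := sc_b_pos mb.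
have sr : sc m ra (se X) by rewrite (same_circleL _ (sc_ra_rb m)) same_circle_sym.
have sl : sc m la (se X) by rewrite (same_circleL _ ma2).
case/innerP=> -> //; first by rewrite same_circle_sym.
by rewrite -(same_circleL _ (sc_la_lb m)).
Qed.

Lemma circle_mm m u : m a = false -> m b = false -> inner X u ->
  same_circle m u (inl nw).
Proof.
move=> ma mb; have [_ ma2] := sc_a_neg ma; have [_ mb2] := sc_b_neg mb.
have sl : sc m la nw by rewrite same_circle_sym.
have sl' : sc m lb nw by rewrite -(same_circleL _ (sc_la_lb m)).
have sr : sc m rb nw by rewrite (same_circleL _ mb2).
case/innerP=> -> //.
by rewrite (same_circleL _ (sc_ra_rb m)).
Qed.

Lemma circle_pm m u : m a -> m b = false -> inner X u -> same_circle m u (inl la).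
Proof.
move=> ma mb; have [_ ma2] := sc_a_pos ma; have [_ mb2] := sc_b_neg mb.
have sr : sc m ra la by rewrite same_circle_sym.
case/innerP=> -> //.
- exact: same_circle_refl.
- by rewrite -(same_circleL _ (sc_ra_rb m)).
- by rewrite same_circle_sym sc_la_lb.
Qed.

Lemma circle_mp m : m a = false -> m b ->
  [/\ sc m la nw, sc m lb nw, sc m sw nw, sc m (ne X) (se X) &
      sc m ra (se X) /\ sc m rb (se X)].
Proof.
move=> ma mb; have [ma1 ma2] := sc_a_neg ma; have [mb1 mb2] := sc_b_pos mb.
have sl : sc m la nw by rewrite same_circle_sym.
have sl' : sc m lb nw by rewrite -(same_circleL _ (sc_la_lb m)).
have sr : sc m rb (se X) by rewrite same_circle_sym.
have sr' : sc m ra (se X) by rewrite (same_circleL _ (sc_ra_rb m)).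
by split=> //; [rewrite -(same_circleL _ mb2)|rewrite (same_circleL _ ma1)].
Qed.

Lemma dart_site_cases d : d.1 \in [set a; b] ->
  (exists k, d = turn k (ne X)) \/ (exists k, d = turn k (se X)).
Proof.
by rewrite !inE => /orP[] /eqP/dart_turn; [left|right].
Qed.

Lemma smooth_inner_pm m d : m a -> m b = false ->
  inner X (inl (smooth m d)) = inner X (inl d).
Proof.
move=> ma mb; have [dX|dX] := boolP (d.1 \in [set a; b]); last first.
  by rewrite !outside_ninner ?smooth_crossing.
by have [[k ->]|[k ->]] := dart_site_cases dX;
  rewrite ?(smooth_a, smooth_b) ?(inner_a, inner_b) ?ma ?mb; elim/Z4_cases: k.
Qed.

(** For [+-] the inner half-edges are closed under [edge] and [smooth], so no circle leaves them. *)
Lemma inner_circle_pm m u v : m a -> m b = false -> same_circle m u v ->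
  inner X u = inner X v.
Proof.
move=> ma mb.
have step x y : adjacent m x y -> inner X x = inner X y.
  case: x y => [d|i] [e|j] //= /orP[] /eqP->; first by rewrite inner_edge.
  by rewrite smooth_inner_pm.
case/connectP=> p; elim: p u => [|z p IHp] u /=; first by move=> _ ->.
by case/andP=> /step-> zp; apply: IHp.
Qed.

(* Pushes the four inner half-edges to the outer arc they belong to; for [+-] the
   small circle may be sent anywhere. *)
Definition push_out m u : strand D :=
  if inner X u then if m a then inl (se X) else inl nw else u.

(** After pushing out, the ends of a step at [a] or [b] either coincide or are the two ends of a
    horizontal arc, and those are joined in [m'] too, whatever its horizontal type. *)
Lemma push_out_circle m m' u v : horizontal m -> horizontal m' ->
  agree_outside m m' -> same_circle m u v ->
  same_circle m' (push_out m u) (push_out m v).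
Proof.
move=> hm hm' mm'; move: u v; apply: connect_homo => -[d|i] [e|j] //= /orP[] /eqP->.
  rewrite /push_out inner_edge; case: ifP => _; first exact: same_circle_refl.
  exact: same_circle_edge.
have [ends1 ends2] := horizontal_ends hm'.
have ends1' : sc m' nw (ne X) by rewrite same_circle_sym.
have ends2' : sc m' sw (se X) by rewrite same_circle_sym.
have [dX|dX] := boolP (d.1 \in [set a; b]); last first.
  rewrite -(smooth_agree (mm' _ dX)).
  have ds : (smooth m' d).1 \notin [set a; b] by rewrite smooth_crossing.
  have F x : x.1 \notin [set a; b] -> push_out m (inl x) = inl x.
    by move=> xX; rewrite /push_out outside_ninner.
  by rewrite !F //; exact: same_circle_smooth.
have refl := same_circle_refl m'.
rewrite -/(same_circle m' _ _).
have [[k ->]|[k ->]] := dart_site_cases dX;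
  rewrite ?(smooth_a, smooth_b) /push_out ?(inner_a, inner_b);
  move: hm; rewrite /horizontal; case: (m a) => /=; case: (m b) => //= _;
  elim/Z4_cases: k; rewrite /= ?Z4_succ_pred ?turn0 //=.
Qed.

Lemma horizontal_circle m m' u v : horizontal m -> horizontal m' ->
  agree_outside m m' -> ~~ inner X u -> ~~ inner X v ->
  same_circle m' u v = same_circle m u v.
Proof.
move=> hm hm' mm' /negPf iu /negPf iv.
have out n w : inner X w = false -> push_out n w = w by rewrite /push_out => ->.
apply/idP/idP => [/(push_out_circle hm' hm (agree_outside_sym mm'))|
                  /(push_out_circle hm hm' mm')]; by rewrite !out.
Qed.

(** The condition under which [outside_eq] leaves a label free. *)
Definition meets Y m u :=
  [exists d : dart D, (d.1 \in Y) && same_circle m u (inl d)].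

Lemma meets_crossing Y m d : d.1 \in Y -> meets Y m (inl d).
Proof. by move=> dY; apply/existsP; exists d; rewrite dY same_circle_refl. Qed.

Lemma meets_circle Y m u v : same_circle m u v -> meets Y m u = meets Y m v.
Proof. by move=> uv; apply: eq_existsb => d; rewrite (same_circleL _ uv). Qed.

Lemma adjacent_agree Y m m' u v :
  (forall c, c \notin Y -> m' c = m c) -> ~~ meets Y m u ->
  adjacent m' u v = adjacent m u v.
Proof.
move=> mm'; case: u v => [d|i] [e|j] //= ud.
by rewrite (@smooth_agree _ m) ?mm' //; apply: contra ud; exact: meets_crossing.
Qed.

(** Every half-edge on a path from [u] also avoids [Y], so the path never passes a changed
    marker. *)
Lemma avoid_circle Y m m' u v :
  (forall c, c \notin Y -> m' c = m c) -> ~~ meets Y m u ->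
  same_circle m' u v = same_circle m u v.
Proof.
move=> mm' mu; apply/idP/idP => /connectP[p].
  elim: p u mu => [|z p IHp] u mu /=; first by move=> _ ->; exact: same_circle_refl.
  rewrite (adjacent_agree z mm') // => /andP[uz zp vl].
  apply: same_circle_trans (connect1 uz) (IHp z _ zp vl).
  by rewrite -(meets_circle _ (connect1 uz)).
elim: p u mu => [|z p IHp] u mu /=; first by move=> _ ->; exact: same_circle_refl.
case/andP=> uz zp vl; have mz : ~~ meets Y m z by rewrite -(meets_circle _ (connect1 uz)).
by apply: same_circle_trans (IHp z mz zp vl); apply: connect1; rewrite (adjacent_agree z mm').
Qed.

Lemma meets_agree Y m m' u :
  (forall c, c \notin Y -> m' c = m c) -> meets Y m' u = meets Y m u.
Proof.
suff H m1 m2 : (forall c, c \notin Y -> m2 c = m1 c) -> meets Y m2 u -> meets Y m1 u.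
  by move=> mm'; apply/idP/idP; apply: H => // c cY; rewrite mm'.
move=> mm' /existsP[d /andP[dY ud]]; apply: contraT => mu; case/negP: (mu).
by apply/existsP; exists d; rewrite dY -(avoid_circle _ mm' mu).
Qed.

(** NW and SE lie on different arcs in both smoothings, so this says that [u] is on the circle of an
    outer arc; unlike [meets [set a; b]] it excludes the small circle of type [+-]. *)
Definition near m u := same_circle m u (inl nw) || same_circle m u (inl (se X)).

Lemma nw_outer : ~~ inner X (inl nw).
Proof. by rewrite inner_a. Qed.

Lemma se_outer : ~~ inner X (inl (se X)).
Proof. by rewrite turn0_se inner_b. Qed.

Lemma site_a k : (turn k (ne X)).1 \in [set a; b].
Proof. by rewrite !inE eqxx. Qed.

Lemma se_site : (se X).1 \in [set a; b].
Proof. by rewrite !inE eqxx orbT. Qed.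

Lemma site_dart_near m d : d.1 \in [set a; b] ->
  near m (inl d) \/ [/\ m a, m b = false & inner X (inl d)].
Proof.
have [mh|] := boolP (horizontal m).
  have [e1 e2] := horizontal_ends mh; have [di|di dX] := boolP (inner X (inl d)).
    move: mh; rewrite /horizontal /near; case: (boolP (m a)) => [ma _|/negPf ma /negPf mb] _.
      case: (boolP (m b)) => [mb|/negPf mb]; last by right.
      by left; rewrite circle_pp ?orbT.
    by left; rewrite circle_mm.
  left; move: di; have [[k ->]|[k ->]] := dart_site_cases dX;
    rewrite ?(inner_a, inner_b) /near; elim/Z4_cases: k => //= _; rewrite ?turn0.
  - by rewrite e1.
  - by rewrite same_circle_refl.
  - by rewrite same_circle_refl orbT.
  - by rewrite -!(same_circleL _ e2) same_circle_refl orbT.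
rewrite /horizontal negb_or negbK => /andP[/negPf ma mb] dX; left.
have [c1 c2 c3 c4 [c5 c6]] := circle_mp ma mb.
by have [[k ->]|[k ->]] := dart_site_cases dX; rewrite /near; elim/Z4_cases: k;
  rewrite ?turn0 ?c1 ?c2 ?c3 ?c4 ?c5 ?c6 ?orbT ?same_circle_refl ?orbT.
Qed.

Lemma near_circle m u v : same_circle m u v -> near m u = near m v.
Proof. by move=> uv; rewrite /near !(same_circleL _ uv). Qed.

Lemma near_meets m u : near m u -> meets [set a; b] m u.
Proof.
case/orP=> uv; apply/existsP; first by exists nw; rewrite site_a.
by exists (se X); rewrite se_site.
Qed.

Lemma meets_site m u : (m a && ~~ m b -> ~~ inner X u) ->
  meets [set a; b] m u = near m u.
Proof.
move=> mu; apply/idP/idP => [/existsP[d /andP[dX ud]]|]; last exact: near_meets.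
have [|[ma mb di]] := site_dart_near m dX; first by rewrite (near_circle ud).
by move: mu; rewrite ma mb (inner_circle_pm ma mb ud) di => /(_ isT).
Qed.

(** Rewritten with [meets], the condition depends only on the markers outside the disk; hence it
    also passes between horizontal and vertical types. *)
Lemma near_agree m m' u : agree_outside m m' -> ~~ inner X u -> near m' u = near m u.
Proof. by move=> mm' ui; rewrite -!meets_site // (meets_agree _ mm'). Qed.

Lemma vertical_near m u : m a = false -> m b -> inner X u -> near m u.
Proof.
move=> ma mb ui; rewrite -meets_site ?ma //.
by case: u ui => [d /inner_crossing dX|i //]; exact: meets_crossing.
Qed.

(** This and the next three lemmas decide which labels a saddle at a single crossing may change:
    from [++], crossing [b] touches only the lower arc; from [+-], crossing [a] touches the upper
    arc and the small circle; in the other two cases both outer arcs are touched. *)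
Lemma meets_b_pp m u : m a -> m b ->
  meets [set b] m u = same_circle m u (inl (se X)).
Proof.
move=> ma mb; apply/existsP/idP => [[d /andP[/set1P dE ud]]|us]; last first.
  by exists (se X); rewrite inE eqxx.
rewrite (same_circleL _ ud); have [k ->] := dart_turn dE.
have [_ e2] : sc m (ne X) nw /\ sc m (se X) sw by apply: horizontal_ends; rewrite /horizontal ma.
elim/Z4_cases: k; rewrite ?turn0 ?same_circle_refl //.
- by apply: circle_pp => //; rewrite inner_b.
- by apply: circle_pp => //; rewrite inner_b.
- by rewrite same_circle_sym.
Qed.

Lemma meets_a_pm m u : m a -> m b = false ->
  meets [set a] m u = same_circle m u (inl nw) || inner X u.
Proof.
move=> ma mb; apply/existsP/idP => [[d /andP[/set1P dE ud]]|].
  rewrite (same_circleL _ ud) (inner_circle_pm ma mb ud); have [k ->] := dart_turn dE.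
  have [e1 _] : sc m (ne X) nw /\ sc m (se X) sw by apply: horizontal_ends; rewrite /horizontal ma.
  rewrite inner_a; elim/Z4_cases: k; rewrite ?turn0 /= ?orbT ?orbF //.
  exact: same_circle_refl.
case/orP=> [us|ui]; first by exists nw; rewrite inE eqxx.
by exists la; rewrite inE eqxx circle_pm.
Qed.

Lemma meets_a_pp m u : m a -> m b -> meets [set a] m u = near m u.
Proof.
move=> ma mb; apply/existsP/idP => [[d /andP[/set1P dE ud]]|].
  have [||[_]] := @site_dart_near m d; rewrite ?dE ?inE ?eqxx ?mb //.
  by rewrite (near_circle ud).
case/orP=> us; first by exists nw; rewrite inE eqxx.
exists la; rewrite inE eqxx (same_circleL _ us) same_circle_sym circle_pp //.
by rewrite inner_a.
Qed.

Lemma meets_b_mp m u : m a = false -> m b -> meets [set b] m u = near m u.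
Proof.
move=> ma mb; have [_ c2 _ _ _] := circle_mp ma mb.
apply/existsP/idP => [[d /andP[/set1P dE ud]]|].
  have [||[_]] := @site_dart_near m d; rewrite ?dE ?inE ?eqxx ?orbT ?mb //.
  by rewrite (near_circle ud).
case/orP=> us; last by exists (se X); rewrite inE eqxx.
by exists lb; rewrite inE eqxx (same_circleL _ us) same_circle_sym c2.
Qed.

(* [saddle] is taken at the half-edges 0 and 2, whereas the site may be rotated. *)
Lemma dart02 d : ~~ odd d.2 ->
  ((d.1, 0 : 'Z_4), (d.1, 2 : 'Z_4)) = (d, turn 2 d) \/
  ((d.1, 0 : 'Z_4), (d.1, 2 : 'Z_4)) = (turn 2 d, d).
Proof.
by case: d => c [[|[|[|[|i]]]] Hi] // _; [left|right]; congr ((c, _), (c, _));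
  apply/val_inj.
Qed.

(** A horizontal type may differ from [-+] at both crossings. So [m] is first replaced by [n] of
    type [--], which has the same outer circles and differs from [m'] only at [b], and then
    [same_circle_flip] applies. *)
Lemma vertical_flip m m' : horizontal m -> m' a = false -> m' b ->
  agree_outside m m' -> sc m' nw (se X) = ~~ sc m nw (se X).
Proof.
move=> hm m'a m'b mm'; pose n := [ffun c => if c == b then false else m' c].
have nb : n b = false by rewrite ffunE eqxx.
have na : n a = false by rewrite ffunE (negPf (site_neq X)).
have hn : horizontal n by rewrite /horizontal nb orbT.
have nm' c : c != b -> m' c = n c by rewrite ffunE => /negPf->.
have mn : agree_outside m n.
  by move=> c cX; rewrite -nm' ?mm' //; apply: contraNneq cX => ->; rewrite !inE eqxx orbT.
rewrite -(horizontal_circle hm hn mn nw_outer se_outer).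
have := @same_circle_flip D n m' b; rewrite nb m'b => /(_ erefl nm').
have [_ c2 _ _ _] := circle_mp m'a m'b.
have lbn : sc n lb nw by apply: circle_mm => //; rewrite inner_b.
rewrite -(same_circleL _ c2) -(same_circleL _ lbn).
case: (dart02 (se_under X)) => /eqP; rewrite xpair_eqE => /andP[/eqP-> /eqP->] //.
by rewrite ![same_circle _ (inl (se X)) _]same_circle_sym.
Qed.

End SiteCircles.

(** * Enhanced states *)

Section EnhancedStates.
Variable D : link_diagram.
Implicit Types (S T : estate D) (m : {ffun crossing D -> bool}).

Lemma label_circle S u v : same_circle (marker S) u v -> label S u = label S v.
Proof. by move=> uv; have /forallP/(_ u)/forallP/(_ v)/implyP/(_ uv)/eqP := valP S. Qed.

Lemma estate_ext S T : marker S =1 marker T -> label S =1 label T -> S = T.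
Proof.
move=> /ffunP m /ffunP l; apply/val_inj; move: m l; rewrite /marker /label.
by case: (val S) (val T) => [? ?] [? ?] /= -> ->.
Qed.

Lemma estate_exists m (l : strand D -> bool) :
  (forall u v, same_circle m u v -> l u = l v) ->
  exists2 S, marker S = m & label S =1 l.
Proof.
move=> lP; have Sm : [forall u, forall v,
    same_circle m u v ==> (finfun l u == finfun l v)].
  apply/forallP => u; apply/forallP => v; apply/implyP => uv.
  by rewrite !ffunE (lP u v uv).
by exists (exist _ (m, finfun l) Sm) => //= u; rewrite ffunE.
Qed.

Lemma mcoefC p q r : mcoef p q r = mcoef q p r.
Proof. by case: p q r => [] []. Qed.

Lemma dcoefC p q r : dcoef p q r = dcoef p r q.
Proof. by case: p q r => [] [] []. Qed.

(** By [same_circle_flip] the half-edges 0 and 2 share a circle, hence a label, on exactly one side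
    of the saddle. On the other side the exchange is commutativity of [m] or cocommutativity of
    [Delta]. *)
Lemma saddleC c S T : marker S c -> ~~ marker T c ->
  saddle [set c] (c, 2) (c, 0) S T = saddle [set c] (c, 0) (c, 2) S T.
Proof.
move=> Sc /negPf Tc; rewrite /saddle; case: ifP => // /andP[/forallP mST _].
have flip : same_circle (marker T) (inl (c, 0)) (inl (c, 2)) =
    ~~ same_circle (marker S) (inl (c, 0)) (inl (c, 2)).
  apply: same_circle_flip; rewrite ?Sc ?Tc // => x xc.
  by move: (mST x); rewrite inE (negPf xc) => /eqP.
rewrite same_circle_sym; case: ifP flip => [S02 _|_ T02].
  by rewrite dcoefC (label_circle S02).
by rewrite mcoefC (label_circle T02).
Qed.

End EnhancedStates.

(** * Exchanging one horizontal type of the site for another *)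

Section SiteStates.
Variables (D : link_diagram) (X : R2_site D).
Local Notation a := (ne X).1.
Local Notation b := (se X).1.
Implicit Types (S T : estate D) (u v : strand D).

Definition agreeb S T :=
  [forall c, (c \in [set a; b]) || (marker T c == marker S c)].

Lemma agreebP S T : reflect (agree_outside X (marker S) (marker T)) (agreeb S T).
Proof.
apply: (iffP forallP) => H c; last by apply/orP; case: (boolP (c \in _)) => [|/H ->]; [left|right].
by move=> cX; move: (H c); rewrite (negPf cX) => /eqP.
Qed.

Lemma agreebC S T : agreeb S T = agreeb T S.
Proof. by apply: eq_forallb => c; rewrite eq_sym. Qed.

Lemma same_ends_agree S T : same_ends X S T -> agree_outside X (marker S) (marker T).
Proof. by case/andP=> /agreebP. Qed.

Lemma same_ends_label S T u : same_ends X S T -> ~~ inner X u -> label T u = label S u.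
Proof. by case/andP=> _ /forallP/(_ u) + /negPf ui; rewrite ui => /eqP. Qed.

Lemma same_endsC S T : same_ends X S T = same_ends X T S.
Proof.
rewrite /same_ends -/(agreeb S T) agreebC; congr andb.
by apply: eq_forallb => u; rewrite eq_sym.
Qed.

Lemma same_endsE S T : same_ends X S T =
  agreeb S T && [forall u, inner X u || (label T u == label S u)].
Proof. by []. Qed.

Lemma site_typeP S ma mb : reflect (marker S a = ma /\ marker S b = mb) (site_type X S ma mb).
Proof. by apply: (iffP andP) => -[/eqP ? /eqP]. Qed.

Lemma site_type_horizontal S ma mb : site_type X S ma mb -> ma || ~~ mb ->
  horizontal X (marker S).
Proof. by move=> /site_typeP[] <- <-. Qed.

Section Resmooth.
Variables (S : estate D) (ma mb eps : bool).
Hypothesis S_hor : horizontal X (marker S).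
Hypothesis m_hor : ma || ~~ mb.

Definition resmoothed T := [&& site_type X T ma mb, same_ends X S T
  & ma && ~~ mb ==> (small_sign X T == eps)].

Lemma resmoothed_uniq T T' : resmoothed T -> resmoothed T' -> T = T'.
Proof.
case/and3P=> /site_typeP[Ta Tb] ST eT /and3P[/site_typeP[T'a T'b] ST' eT'].
have mE : marker T =1 marker T'.
  move=> c; have [/set2P[]->|cX] := boolP (c \in [set a; b]); rewrite ?Ta ?Tb //.
  by rewrite (same_ends_agree ST) // (same_ends_agree ST').
apply: estate_ext => // u; have [ui|ui] := boolP (inner X u); last first.
  by rewrite (same_ends_label ST) // (same_ends_label ST').
have out v : ~~ inner X v -> label T v = label T' v.
  by move=> vi; rewrite (same_ends_label ST) // (same_ends_label ST').
move: m_hor eT eT'; case Da: (ma); case Db: (mb) => //= _.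
- move=> _ _; rewrite !(label_circle (circle_pp _ _ ui)) ?Ta ?Tb ?T'a ?T'b //.
  by apply: out; exact: se_outer.
- move=> /eqP eT /eqP eT'.
  by rewrite !(label_circle (circle_pm _ _ ui)) ?Ta ?Tb ?T'a ?T'b // -/(small_sign X T) eT.
- move=> _ _; rewrite !(label_circle (circle_mm _ _ ui)) ?Ta ?Tb ?T'a ?T'b //.
  by apply: out; exact: nw_outer.
Qed.

Lemma resmoothed_exists : exists T, resmoothed T.
Proof.
pose m : {ffun crossing D -> bool} :=
  [ffun c => if c == a then ma else if c == b then mb else marker S c].
have mA : m a = ma by rewrite ffunE eqxx.
have mB : m b = mb by rewrite ffunE eq_sym (negPf (site_neq X)) eqxx.
have mS : agree_outside X m (marker S).
  by move=> c; rewrite !inE ffunE negb_or => /andP[/negPf-> /negPf->].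
have hm : horizontal X m by rewrite /horizontal mA mB.
(* Inner half-edges take the label of the outer arc to which the new markers attach them, except on
   the small circle. *)
pose l u := if ma && ~~ mb && inner X u then eps else label S (push_out X m u).
have lP u v : same_circle m u v -> l u = l v.
  move=> uv; rewrite /l; case: (boolP (ma && ~~ mb)) => [/andP[ha hb]|_] /=.
    rewrite (inner_circle_pm (X := X) _ _ uv) ?mA ?mB ?(negPf hb) //; case: ifP => // _.
    exact/label_circle/push_out_circle/uv.
  exact/label_circle/push_out_circle/uv.
have [T mT lT] := estate_exists lP; exists T; apply/and3P; split.
- by apply/site_typeP; rewrite mT.
- apply/andP; split; apply/forallP => c; last first.
    rewrite lT /l /push_out; case: (inner X c) => //=; by rewrite andbF.
  by rewrite mT; case: (boolP (c \in _)) => //= /mS ->.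
- by apply/implyP => mm; rewrite /small_sign lT /l mm inner_a.
Qed.

(** Under the hypotheses of this section a candidate exists, so the default [S] is never returned
    for want of one. *)
Definition resmooth := odflt S [pick T | resmoothed T].

Lemma resmoothP T : resmoothed T = (T == resmooth).
Proof.
have R : resmoothed resmooth.
  by rewrite /resmooth; case: pickP => [//|no]; case: resmoothed_exists => U; rewrite no.
by apply/idP/eqP => [TR|->]; [apply: resmoothed_uniq|].
Qed.

Lemma resmooth_spec : resmoothed resmooth.
Proof. by rewrite resmoothP. Qed.

End Resmooth.

End SiteStates.

(** * Saddles at the site *)

Section SiteSaddles.
Variables (D : link_diagram) (X : R2_site D).
Local Notation a := (ne X).1.
Local Notation b := (se X).1.
Local Notation nw := (turn 1 (ne X)).
Local Notation la := (turn 2 (ne X)).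
Local Notation lb := (turn 2 (se X)).
Implicit Types (S T : estate D) (u v : strand D) (Y : {set crossing D}).

Local Notation lnw S := (label S (inl nw)).
Local Notation lse S := (label S (inl (se X))).
Local Notation linked S := (same_circle (marker S) (inl nw) (inl (se X))).

Definition far_eq S T :=
  [forall u, inner X u || near X (marker S) u || (label T u == label S u)].

(** The common value of three coefficients: of the saddle at [a] from [++], of the saddle at [b]
    from [-+], and of [site_saddle]. *)
Definition saddle_coef S T : Zst :=
  if agreeb X S T && far_eq S T then
    if linked S then dcoef (lnw S) (lnw T) (lse T)
    else mcoef (lnw S) (lse S) (lnw T)
  else 0.

Lemma saddle_a S T : marker S a -> ~~ marker T a ->
  saddle [set a] (a, 0) (a, 2) S T = saddle [set a] (ne X) la S T.
Proof.
move=> Sa Ta; case: (dart02 (ne_under X)) => /eqP; rewrite xpair_eqE;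
  case/andP=> /eqP e0 /eqP e2; last rewrite -saddleC //; by rewrite e0 e2.
Qed.

Lemma saddle_b S T : marker S b -> ~~ marker T b ->
  saddle [set b] (b, 0) (b, 2) S T = saddle [set b] (se X) lb S T.
Proof.
move=> Sb Tb; case: (dart02 (se_under X)) => /eqP; rewrite xpair_eqE;
  case/andP=> /eqP e0 /eqP e2; last rewrite -saddleC //; by rewrite e0 e2.
Qed.

Lemma outside_far Y S T : Y \subset [set a; b] ->
  {in [set a; b] :\: Y, forall c, marker T c = marker S c} ->
  (forall u, meets Y (marker S) u = inner X u || near X (marker S) u) ->
  outside_eq Y S T = agreeb X S T && far_eq S T.
Proof.
move=> /subsetP Yab mST mY; congr andb; last first.
  by apply: eq_forallb => u; rewrite -mY.
apply: eq_forallb => c; case: (boolP (c \in Y)) => [/Yab-> //|cY] /=.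
by case: (boolP (c \in [set a; b])) => // cX; rewrite mST ?eqxx // inE cY.
Qed.

(** After the saddle NE lies on the arc of SE, and [la] on that of NW, so the new labels appear in
    the opposite order. In a split cocommutativity absorbs this; in a merge [vertical_flip] puts
    both ends on one circle. *)
Lemma saddle_coef_pp_mp S T : site_type X S true true -> site_type X T false true ->
  saddle [set a] (a, 0) (a, 2) S T = saddle_coef S T.
Proof.
move=> /site_typeP[Sa Sb] /site_typeP[Ta Tb]; rewrite saddle_a ?Sa ?Ta //.
have hS : horizontal X (marker S) by rewrite /horizontal Sa.
have [eS _] := horizontal_ends hS; have [c1 c2 c3 c4 _] := circle_mp Ta Tb.
have sla : same_circle (marker S) (inl la) (inl (se X)).
  by apply: circle_pp; rewrite // inner_a.
rewrite /saddle /saddle_coef outside_far; first last.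
- move=> u; rewrite meets_a_pp //; apply/idP/idP => [->|]; first by rewrite orbT.
  by case/orP=> // ui; rewrite /near circle_pp ?orbT.
- by move=> c; rewrite !inE => /andP[/negPf-> /eqP->]; rewrite Sb Tb.
- by apply/subsetP => c; rewrite !inE => ->.
case: ifP => // /andP[/agreebP ag _].
have flip := vertical_flip hS Ta Tb ag.
rewrite (same_circleL _ eS) (same_circleR _ sla) (label_circle eS) (label_circle sla).
rewrite (label_circle c1) (label_circle c4).
by case: ifP flip => [_ _|_ /label_circle->] //; rewrite dcoefC.
Qed.

Lemma saddle_coef_mp_mm S T : site_type X S false true -> site_type X T false false ->
  saddle [set b] (b, 0) (b, 2) S T = saddle_coef S T.
Proof.
move=> /site_typeP[Sa Sb] /site_typeP[Ta Tb]; rewrite saddle_b ?Sb ?Tb //.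
have hT : horizontal X (marker T) by rewrite /horizontal Tb orbT.
have [c1 c2 c3 c4 _] := circle_mp Sa Sb.
have tlb : same_circle (marker T) (inl lb) (inl nw).
  by apply: circle_mm; rewrite // inner_b.
rewrite /saddle /saddle_coef outside_far; first last.
- move=> u; rewrite meets_b_mp //; apply/idP/idP => [->|]; first by rewrite orbT.
  by case/orP=> // ui; rewrite vertical_near.
- by move=> c; rewrite !inE => /andP[/negPf cb]; rewrite cb orbF => /eqP->; rewrite Sa Ta.
- by apply/subsetP => c; rewrite !inE => ->; rewrite orbT.
case: ifP => // /andP[/agreebP ag _].
have flip := vertical_flip hT Sa Sb (agree_outside_sym ag).
rewrite (same_circleR _ c2) same_circle_sym (label_circle c2) (label_circle tlb).
case: ifP flip => [l _|_ ]; first by rewrite dcoefC (label_circle l).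
by move/esym/negbFE/label_circle->; rewrite mcoefC.
Qed.

Lemma site_saddle_coef S T :
  (site_type X S true false && site_type X T false true) ||
  (site_type X S false true && site_type X T true false) ->
  site_saddle X S T = saddle_coef S T.
Proof.
move=> st; rewrite /site_saddle /saddle /saddle_coef outside_far //.
  by move=> c; rewrite setDv in_set0.
move=> u; case/orP: st => /andP[/site_typeP[Sa Sb] _].
  have [ui|ui] /= := boolP (inner X u); last by rewrite meets_site.
  by case: u ui => [d /inner_crossing dX|] //; exact: meets_crossing.
rewrite meets_site ?Sa //; have [ui|//] := boolP (inner X u).
by rewrite vertical_near.
Qed.

(** The saddle at [b] cuts the small circle off the lower arc, so it is always a split. If
    [linked S], the upper arc belongs to the circle being split, and its label is allowed to
    change. *)
Lemma saddle_pp_pm S T : site_type X S true true -> site_type X T true false ->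
  saddle [set b] (b, 0) (b, 2) S T =
  if [&& agreeb X S T, far_eq S T & linked S || (lnw T == lnw S)]
  then dcoef (lse S) (lse T) (small_sign X T) else 0.
Proof.
move=> /site_typeP[Sa Sb] /site_typeP[Ta Tb]; rewrite saddle_b ?Sb ?Tb //.
have hS : horizontal X (marker S) by rewrite /horizontal Sa.
have hT : horizontal X (marker T) by rewrite /horizontal Ta.
have slb : same_circle (marker S) (inl lb) (inl (se X)).
  by apply: circle_pp; rewrite // inner_b.
have tlb : same_circle (marker T) (inl lb) (inl la).
  by apply: circle_pm; rewrite // inner_b.
rewrite /saddle same_circle_sym slb (label_circle tlb) -/(small_sign X T).
congr (if _ then _ else _); rewrite /outside_eq; set ag := (X in X && _).
have -> : ag = agreeb X S T.
  apply: eq_forallb => c; rewrite !inE; case: (c == b) => //=; rewrite ?orbT // orbF.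
  by case: (c =P _) => [->|] //; rewrite Sa Ta.
case: (boolP (agreeb X S T)) => //= /agreebP {}ag.
apply/forallP/andP => [H|[/forallP far eq_nw] u]; last first.
  rewrite -/(meets _ _ _) meets_b_pp //.
  have [ui|ui] := boolP (inner X u); first by rewrite circle_pp.
  move: (far u); rewrite (negPf ui) /= /near; case/orP=> [/orP[unw|->]|->] //; last by rewrite orbT.
  case/orP: eq_nw => [l|/eqP eq_nw]; first by rewrite (same_circleL _ unw) l.
  have := unw; rewrite -(horizontal_circle hS hT ag) ?nw_outer // => /label_circle->.
  by rewrite (label_circle unw) eq_nw eqxx orbT.
split; last by have := H (inl nw); rewrite -/(meets _ _ _) meets_b_pp.
apply/forallP => u; have := H u; rewrite -/(meets _ _ _) meets_b_pp // /near.
by case/orP=> ->; rewrite !orbT.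
Qed.

(** The saddle at [a] joins the small circle to the upper arc, so it is always a merge; the lower
    arc keeps its label unless it lies on the same circle. *)
Lemma saddle_pm_mm S T : site_type X S true false -> site_type X T false false ->
  saddle [set a] (a, 0) (a, 2) S T =
  if [&& agreeb X S T, far_eq S T & linked S || (lse T == lse S)]
  then mcoef (lnw S) (small_sign X S) (lnw T) else 0.
Proof.
move=> /site_typeP[Sa Sb] /site_typeP[Ta Tb]; rewrite saddle_a ?Sa ?Ta //.
have hS : horizontal X (marker S) by rewrite /horizontal Sa.
have hT : horizontal X (marker T) by rewrite /horizontal Tb orbT.
have [sne _] := horizontal_ends hS; have [tne _] := horizontal_ends hT.
have nla : same_circle (marker S) (inl nw) (inl la) = false.
  by apply/negP => /(inner_circle_pm Sa Sb); rewrite !inner_a.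
rewrite /saddle (same_circleL _ sne) nla (label_circle sne) (label_circle tne).
rewrite -/(small_sign X S).
congr (if _ then _ else _); rewrite /outside_eq; set ag := (X in X && _).
have -> : ag = agreeb X S T.
  apply: eq_forallb => c; rewrite !inE; case: (c == a) => //=.
  by case: (c =P _) => [->|] //; rewrite Sb Tb.
case: (boolP (agreeb X S T)) => //= /agreebP {}ag.
apply/forallP/andP => [H|[/forallP far eq_se] u]; last first.
  rewrite -/(meets _ _ _) meets_a_pm //.
  have [ui|ui] := boolP (inner X u); first by rewrite orbT.
  move: (far u); rewrite (negPf ui) /= orbF /near; case/orP=> [/orP[->|use]|->] //; last by rewrite orbT.
  case/orP: eq_se => [l|/eqP eq_se]; first by rewrite (same_circleR _ l) use.
  have := use; rewrite -(horizontal_circle hS hT ag) ?se_outer // => /label_circle->.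
  by rewrite (label_circle use) eq_se eqxx orbT.
split.
  apply/forallP => u; have := H u; rewrite -/(meets _ _ _) meets_a_pm // /near.
  by case/orP=> [/orP[]|] ->; rewrite ?orbT.
have := H (inl (se X)); rewrite -/(meets _ _ _) meets_a_pm // same_circle_sym.
by rewrite (negPf (se_outer X)) orbF.
Qed.

End SiteSaddles.

(** * Unit and counit laws, and saddles outside the disk *)

Section SaddleIdentities.
Variables (D : link_diagram) (X : R2_site D).
Local Notation a := (ne X).1.
Local Notation b := (se X).1.
Local Notation nw := (turn 1 (ne X)).
Local Notation la := (turn 2 (ne X)).
Implicit Types (S T : estate D) (u v : strand D) (c : crossing D).

Local Notation lnw S := (label S (inl nw)).
Local Notation lse S := (label S (inl (se X))).
Local Notation linked S := (same_circle (marker S) (inl nw) (inl (se X))).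

Lemma same_ends_nw S T : same_ends X S T -> lnw T = lnw S.
Proof. by move/same_ends_label; apply; exact: nw_outer. Qed.

Lemma same_ends_se S T : same_ends X S T -> lse T = lse S.
Proof. by move/same_ends_label; apply; exact: se_outer. Qed.

Lemma same_ends_linked S T : horizontal X (marker S) -> horizontal X (marker T) ->
  same_ends X S T -> linked T = linked S.
Proof.
move=> hS hT /same_ends_agree ST.
by rewrite (horizontal_circle hS hT ST) ?nw_outer ?se_outer.
Qed.

Lemma agreeb_trans S S' T : agreeb X S S' -> agreeb X S T = agreeb X S' T.
Proof.
move=> SS'; apply: eq_forallb => c; case: (boolP (c \in _)) => //= cX.
by move/forallP: SS' => /(_ c); rewrite (negPf cX) /= => /eqP->.
Qed.

Lemma same_ends_far_l S S' T : same_ends X S S' -> far_eq X S T = far_eq X S' T.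
Proof.
move=> SS'; apply: eq_forallb => u; have [//|ui] := boolP (inner X u).
by rewrite (near_agree (same_ends_agree SS') ui) (same_ends_label SS' ui).
Qed.

Lemma same_ends_far_r S T T' : same_ends X T T' -> far_eq X S T = far_eq X S T'.
Proof.
move=> TT'; apply: eq_forallb => u; have [//|ui] := boolP (inner X u).
by rewrite (same_ends_label TT' ui).
Qed.

Lemma saddle_coef_l S S' T : horizontal X (marker S) -> horizontal X (marker S') ->
  same_ends X S S' -> saddle_coef X S T = saddle_coef X S' T.
Proof.
move=> hS hS' SS'; rewrite /saddle_coef (same_ends_far_l _ SS') (same_ends_linked hS hS' SS').
have /andP[/agreeb_trans-> _] := SS'.
by rewrite (same_ends_nw SS') (same_ends_se SS').
Qed.

Lemma saddle_coef_r S T T' : same_ends X T T' -> saddle_coef X S T = saddle_coef X S T'.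
Proof.
move=> TT'; rewrite /saddle_coef (same_ends_far_r _ TT').
have /andP[/agreeb_trans TT'a _] := TT'.
by rewrite agreebC TT'a agreebC (same_ends_nw TT') (same_ends_se TT').
Qed.

Lemma same_endsP S T : horizontal X (marker S) -> horizontal X (marker T) ->
  same_ends X S T =
  [&& agreeb X S T, far_eq X S T, lnw T == lnw S & lse T == lse S].
Proof.
move=> hS hT; rewrite same_endsE; case: (boolP (agreeb X S T)) => //= /agreebP ST.
apply/forallP/and3P => [H|[/forallP far /eqP eq_nw /eqP eq_se] u].
  split; [|by have := H (inl nw); rewrite (negPf (nw_outer X))
    |by have := H (inl (se X)); rewrite (negPf (se_outer X))].
  by apply/forallP => u; case/orP: (H u) => ->; rewrite ?orbT.
have [//|ui] := boolP (inner X u); move: (far u); rewrite (negPf ui) /=.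
case/orP=> // /orP[] us; have ut := us.
  rewrite -(horizontal_circle hS hT ST) ?nw_outer // in ut.
  by rewrite (label_circle us) (label_circle ut) eq_nw.
rewrite -(horizontal_circle hS hT ST) ?se_outer // in ut.
by rewrite (label_circle us) (label_circle ut) eq_se.
Qed.

Lemma linked_labels S T : horizontal X (marker S) -> horizontal X (marker T) ->
  agreeb X S T -> linked S -> (lnw T == lnw S) = (lse T == lse S).
Proof.
move=> hS hT /agreebP ST l; have l' := l.
rewrite -(horizontal_circle hS hT ST) ?nw_outer ?se_outer // in l'.
by rewrite (label_circle l) (label_circle l').
Qed.

(** The coefficient of [q ⊗ +] in [Delta(p)] is 1 if [p = q] and 0 otherwise: taking the coefficient
    of [+] is the counit. *)
Lemma saddle_pp_pm_pos S T : site_type X S true true -> site_type X T true false ->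
  small_sign X T -> saddle [set b] (b, 0) (b, 2) S T = (same_ends X S T)%:R.
Proof.
move=> St Tt Te; rewrite (saddle_pp_pm St Tt) Te.
have hS := site_type_horizontal St isT; have hT := site_type_horizontal Tt isT.
rewrite same_endsP //; case: (boolP (agreeb X S T)) => //= ag.
case: (far_eq X S T) => //=; have := linked_labels hS hT ag.
case: (linked S) => [/(_ isT)->|_] /=;
  by case: (lse S) (lse T) (lnw T == lnw S) => [] [] [].
Qed.

(** The sign [-] is the unit of [m], so merging a small circle with this sign changes no label. *)
Lemma saddle_pm_mm_neg S T : site_type X S true false -> ~~ small_sign X S ->
  site_type X T false false -> saddle [set a] (a, 0) (a, 2) S T = (same_ends X S T)%:R.
Proof.
move=> St /negPf Se Tt; rewrite (saddle_pm_mm St Tt) Se.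
have hS := site_type_horizontal St isT; have hT := site_type_horizontal Tt isT.
rewrite same_endsP //; case: (boolP (agreeb X S T)) => //= ag.
case: (far_eq X S T) => //=; have := linked_labels hS hT ag.
case: (linked S) => [/(_ isT)<-|_] /=; rewrite ?andbb;
  by case: (lnw S) (lnw T) (lse T == lse S) => [] [] [].
Qed.

Lemma meets_outer c S S' u : c \notin [set a; b] ->
  horizontal X (marker S) -> horizontal X (marker S') ->
  same_ends X S S' -> ~~ inner X u ->
  meets [set c] (marker S') u = meets [set c] (marker S) u.
Proof.
move=> cX hS hS' SS' ui; apply: eq_existsb => d.
case: (boolP (d.1 \in [set c])) => //= /set1P dc.
rewrite (horizontal_circle hS hS' (same_ends_agree SS')) //.
by rewrite outside_ninner // dc.
Qed.

(** Inner labels add no condition of their own: they repeat the label of an outer arc, except on the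
    small circle, where the assumption on [small_sign] takes over. *)
Lemma outside_outer c S S' T T' ma mb ma' mb' :
  c \notin [set a; b] -> ma || ~~ mb -> ma' || ~~ mb' ->
  site_type X S ma mb -> site_type X T ma mb ->
  site_type X S' ma' mb' -> site_type X T' ma' mb' ->
  (ma' && ~~ mb' -> small_sign X S' = small_sign X T') ->
  same_ends X S S' -> same_ends X T T' ->
  outside_eq [set c] S T -> outside_eq [set c] S' T'.
Proof.
move=> cX hm hm' St Tt S't T't eps SS' TT' /andP[/forallP mST /forallP lST].
have hS := site_type_horizontal St hm; have hS' := site_type_horizontal S't hm'.
have hT' := site_type_horizontal T't hm'.
have /site_typeP[S'a S'b] := S't; have /site_typeP[T'a T'b] := T't.
have out u : ~~ inner X u ->
    meets [set c] (marker S') u || (label T' u == label S' u).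
  move=> ui; rewrite (meets_outer cX hS hS' SS' ui).
  by rewrite (same_ends_label SS' ui) (same_ends_label TT' ui); apply: lST.
apply/andP; split; apply/forallP => u.
  have [/set2P[]->|uX] := boolP (u \in [set a; b]).
  - by rewrite S'a T'a eqxx orbT.
  - by rewrite S'b T'b eqxx orbT.
  by rewrite (same_ends_agree SS') // (same_ends_agree TT').
rewrite -/(meets _ _ _); have [ui|] := boolP (inner X u); last exact: out.
move: hm' eps S'a T'a S'b T'b; case: ma' {S't T't} => /=; case: mb' => //= _ eps S'a T'a S'b T'b.
- rewrite (meets_circle _ (circle_pp S'a S'b ui)) (label_circle (circle_pp S'a S'b ui)).
  by rewrite (label_circle (circle_pp T'a T'b ui)); apply/out/se_outer.
- rewrite (label_circle (circle_pm S'a S'b ui)) (label_circle (circle_pm T'a T'b ui)).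
  by rewrite -!/(small_sign _ _) eps // eqxx orbT.
rewrite (meets_circle _ (circle_mm S'a S'b ui)) (label_circle (circle_mm S'a S'b ui)).
by rewrite (label_circle (circle_mm T'a T'b ui)); apply/out/nw_outer.
Qed.

Lemma saddle_outer c S S' T T' ma mb ma' mb' :
  c \notin [set a; b] -> ma || ~~ mb -> ma' || ~~ mb' ->
  site_type X S ma mb -> site_type X T ma mb ->
  site_type X S' ma' mb' -> site_type X T' ma' mb' ->
  (ma && ~~ mb -> small_sign X S = small_sign X T) ->
  (ma' && ~~ mb' -> small_sign X S' = small_sign X T') ->
  same_ends X S S' -> same_ends X T T' ->
  saddle [set c] (c, 0) (c, 2) S T = saddle [set c] (c, 0) (c, 2) S' T'.
Proof.
move=> cX hm hm' St Tt S't T't eps eps' SS' TT'.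
have hS := site_type_horizontal St hm; have hS' := site_type_horizontal S't hm'.
have ci k : ~~ inner X (inl (c, k)) by rewrite outside_ninner.
have oE : outside_eq [set c] S T = outside_eq [set c] S' T'.
  apply/idP/idP; first exact: (outside_outer cX hm hm' St Tt S't T't eps' SS' TT').
  by apply: (outside_outer cX hm' hm S't T't St Tt eps); rewrite same_endsC.
rewrite /saddle oE (horizontal_circle hS hS' (same_ends_agree SS')) //.
by rewrite !(same_ends_label SS') // !(same_ends_label TT').
Qed.

(** The small circle consists of inner half-edges only, so it does not pass through [c] and keeps
    its sign. *)
Lemma saddle_outer_type c S T : c \notin [set a; b] ->
  saddle [set c] (c, 0) (c, 2) S T != 0 ->
  [/\ marker T a = marker S a, marker T b = marker S b &
      marker S a && ~~ marker S b -> small_sign X S = small_sign X T].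
Proof.
rewrite /saddle; case: ifP; last by rewrite eqxx.
case/andP=> /forallP mST /forallP lST cX _.
have ac : a \in [set c] = false by apply: contraNF cX => /set1P<-; rewrite !inE eqxx.
have bc : b \in [set c] = false by apply: contraNF cX => /set1P<-; rewrite !inE eqxx orbT.
split; first by have := mST a; rewrite ac => /eqP.
  by have := mST b; rewrite bc /= => /eqP.
case/andP=> Sa /negPf Sb; have := lST (inl la); rewrite -/(meets _ _ _).
case: (boolP (meets _ _ _)) => [+ _|_ /eqP lE]; last by rewrite /small_sign lE.
case/existsP=> d /andP[/set1P dc] /(inner_circle_pm Sa Sb).
by rewrite inner_a outside_ninner ?dc.
Qed.

End SaddleIdentities.

(** * Two successive saddles at the site *)

Section DoubleSaddle.
Variables (D : link_diagram) (X : R2_site D).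
Local Notation a := (ne X).1.
Local Notation b := (se X).1.
Local Notation nw := (turn 1 (ne X)).
Implicit Types (S T : estate D) (u v : strand D) (c : crossing D).

Local Notation lnw S := (label S (inl nw)).
Local Notation lse S := (label S (inl (se X))).
Local Notation linked S := (same_circle (marker S) (inl nw) (inl (se X))).

Definition vertical_over S T :=
  [&& site_type X T false true, agreeb X S T & far_eq X S T].

Lemma vertical_over_uniq S T T' : vertical_over S T -> vertical_over S T' ->
  lnw T = lnw T' -> lse T = lse T' -> T = T'.
Proof.
case/and3P=> /site_typeP[Ta Tb] /agreebP agT /forallP farT.
case/and3P=> /site_typeP[T'a T'b] /agreebP agT' /forallP farT' enw ese.
have mE : marker T =1 marker T'.
  move=> c; have [/set2P[]->|cX] := boolP (c \in [set a; b]); rewrite ?Ta ?Tb //.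
  by rewrite agT // agT'.
have mE' : marker T = marker T' by apply/ffunP.
apply: estate_ext => // u; have [|nu] := boolP (near X (marker T) u).
  case/orP=> us; have us' := us; rewrite mE' in us'.
    by rewrite (label_circle us) (label_circle us').
  by rewrite (label_circle us) (label_circle us').
have ui : ~~ inner X u by apply: contra nu; apply: vertical_near.
have nS : near X (marker S) u = false by rewrite -(near_agree agT ui) (negPf nu).
by move: (farT u) (farT' u); rewrite (negPf ui) nS /= => /eqP-> /eqP->.
Qed.

Lemma vertical_over_exists S r s : horizontal X (marker S) -> linked S || (r == s) ->
  exists T, [/\ vertical_over S T, lnw T = r & lse T = s].
Proof.
move=> hS rs; pose m : {ffun crossing D -> bool} :=
  [ffun c => if c == a then false else if c == b then true else marker S c].
have mA : m a = false by rewrite ffunE eqxx.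
have mB : m b by rewrite ffunE eq_sym (negPf (site_neq X)) eqxx.
have Sm : agree_outside X (marker S) m.
  by move=> c; rewrite !inE ffunE negb_or => /andP[/negPf-> /negPf->].
pose l u := if same_circle m u (inl nw) then r
  else if same_circle m u (inl (se X)) then s else label S u.
have lP u v : same_circle m u v -> l u = l v.
  move=> uv; rewrite /l -!(same_circleL _ uv); case: ifP => // unw; case: ifP => // use.
  apply: label_circle; rewrite (avoid_circle _ (agree_outside_sym Sm)) //.
  by rewrite (@meets_site _ X) ?mA // /near unw use.
have [T mT lT] := estate_exists lP; exists T; split.
- apply/and3P; split; first by apply/site_typeP; rewrite mT mA.
    by apply/agreebP; rewrite mT.
  apply/forallP => u; have [//|ui] := boolP (inner X u).
  rewrite -(near_agree Sm ui) lT /l /near; case: same_circle => //.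
  by case: same_circle => //=.
- by rewrite lT /l same_circle_refl.
(* If NW and SE share a circle of [m], it was given [r]; but then [S] is not linked and [rs] yields
   [r = s]. *)
rewrite lT /l same_circle_refl same_circle_sym (vertical_flip hS mA mB Sm).
by case: (linked S) rs => //= /eqP.
Qed.

Lemma vertical_over_linked S T : horizontal X (marker S) -> vertical_over S T ->
  linked T = ~~ linked S.
Proof. by move=> hS /and3P[/site_typeP[Ta Tb] /agreebP ag _]; apply: vertical_flip. Qed.

(** An intermediate state is determined by the labels of its two arcs. They are independent if the
    first saddle splits the circle of [S], and equal if it merges two circles. *)
Lemma vertical_sum S (K : bool -> bool -> Zst) : horizontal X (marker S) ->
  \sum_(T | vertical_over S T) K (lnw T) (lse T)
  = if linked S then \sum_r \sum_s K r s else \sum_r K r r.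
Proof.
move=> hS; rewrite (partition_big (fun T => (lnw T, lse T)) predT) //=.
transitivity (\sum_(rs : bool * bool)
    if linked S || (rs.1 == rs.2) then K rs.1 rs.2 else 0).
  apply: eq_bigr => -[r s] _ /=; case: ifP => rs.
    have [T [TS Tr Ts]] := vertical_over_exists hS rs.
    rewrite (big_pred1 T) ?Tr ?Ts // => T'; apply/andP/eqP => [[T'S /eqP[T'r T's]]|->].
      by apply: vertical_over_uniq T'S TS _ _; rewrite ?Tr ?Ts.
    by rewrite Tr Ts.
  rewrite big_pred0 // => T; apply/negP => /andP[TS /eqP[Tr Ts]]; move/negP: rs; apply.
  have := vertical_over_linked hS TS; case: (linked S) => //= /label_circle.
  by rewrite Tr Ts => ->.
rewrite -(pair_bigA _ (fun r s => if linked S || (r == s) then K r s else 0)) /=.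
by case: (linked S) => //=; rewrite !big_bool /= addr0 add0r.
Qed.

(** The left side is the coefficient of [p' ⊗ q'] in [Delta(m(p:q))]. For [p = q = +] the products
    of [ps] and [pt] at [- ⊗ -] cancel, thanks to the term [- ps] of [Delta(-)]. *)
Lemma double_saddle_unlinked p q p' q' :
  \sum_r mcoef p q r * dcoef r p' q' =
  (if p' == p then dcoef q q' false else 0) + (if q' == q then mcoef p true p' else 0).
Proof.
rewrite big_bool; case: p q p' q' => [] [] [] [] /=;
  by rewrite ?(mulr0, mul0r, mulr1, mul1r, addr0, add0r, mulrN) ?[pt * ps]mulrC ?subrr ?addNr.
Qed.

(** [m] after [Delta] is multiplication by [m(Delta(-)) = 2(+) - s(-)]; the two terms on the right
    add up to this product with [p]. *)
Lemma double_saddle_linked p p' :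
  \sum_r \sum_s dcoef p r s * mcoef r s p' = dcoef p p' false + mcoef p true p'.
Proof.
rewrite !big_bool; case: p p' => [] [] /=;
  by rewrite ?(mulr0, mul0r, mulr1, mul1r, addr0, add0r, mulrN) ?[pt * ps]mulrC ?subrr ?addNr.
Qed.

(* In the notation E^+_{+-}(p,q), the first term is E^-_{+-}(p, Delta(q)) and the
   second comes from E_{--}(m(+ : p), q). *)
Lemma double_saddle_coef S S0 T U : site_type X S true false -> small_sign X S ->
  site_type X S0 true true -> same_ends X S S0 ->
  site_type X T true false -> ~~ small_sign X T ->
  site_type X U false false -> same_ends X T U ->
  \sum_(T' | site_type X T' false true) site_saddle X S T' * site_saddle X T' T
  = saddle [set b] (b, 0) (b, 2) S0 T + saddle [set a] (a, 0) (a, 2) S U.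
Proof.
move=> St Se S0t SS0 Tt /negPf Te Ut TU.
have hS := site_type_horizontal St isT; have hT := site_type_horizontal Tt isT.
have hS0 := site_type_horizontal S0t isT; have hU := site_type_horizontal Ut isT.
have /andP[/agreeb_trans SS0a _] := SS0; have /andP[/agreeb_trans TUa _] := TU.
rewrite (saddle_pp_pm S0t Tt) (saddle_pm_mm St Ut) -SS0a -(same_ends_far_l _ SS0).
rewrite [agreeb X S U]agreebC -TUa [agreeb X T S]agreebC -(same_ends_far_r _ TU).
rewrite (same_ends_linked hS hS0 SS0) (same_ends_nw SS0) (same_ends_se SS0).
rewrite (same_ends_nw TU) (same_ends_se TU) Te Se.
(* The product of the two coefficients as a function of the labels of the intermediate state; the
   remaining condition compares only [S] and [T]. *)
pose K r s : Zst := if agreeb X S T && far_eq X S T then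
   (if linked S then dcoef (lnw S) r s * mcoef r s (lnw T)
    else mcoef (lnw S) (lse S) r * dcoef r (lnw T) (lse T)) else 0.
transitivity (\sum_(T' | vertical_over S T') K (lnw T') (lse T')).
  rewrite (bigID (fun T' => agreeb X S T' && far_eq X S T')) /= [X in _ + X]big1 ?addr0.
    apply: eq_big => T' //; case/andP=> T't agf; have /andP[ag far] := agf.
    have T'S : vertical_over S T' by rewrite /vertical_over T't.
    rewrite !site_saddle_coef ?St ?Tt ?T't ?orbT // /saddle_coef agf /K.
    rewrite (vertical_over_linked hS T'S) -(agreeb_trans _ ag).
    have -> : far_eq X T' T = far_eq X S T.
      apply: eq_forallb => u; have [//|ui /=] := boolP (inner X u).
      rewrite (near_agree (agreebP _ _ _ ag) ui); case: (boolP (near _ _ _)) => //= nu.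
      by move/forallP: far => /(_ u); rewrite (negPf ui) (negPf nu) /= => /eqP->.
    by case: (_ && _); case: (linked S); rewrite ?mulr0.
  move=> T' /andP[T't /negPf agf].
  by rewrite site_saddle_coef ?St ?T't // /saddle_coef agf mul0r.
rewrite vertical_sum // /K; case: (boolP (agreeb X S T)) => /= [ag|_]; last first.
  by rewrite !big1 // ?addr0 ?if_same // => r _; rewrite big1.
case: (far_eq X S T) => /=; last first.
  by rewrite !big1 // ?addr0 ?if_same // => r _; rewrite big1.
have [l|_] /= := boolP (linked S); last exact: double_saddle_unlinked.
have lT : linked T.
  by rewrite (horizontal_circle hS hT (agreebP _ _ _ ag)) ?nw_outer ?se_outer.
by rewrite -(label_circle l) -(label_circle lT) double_saddle_linked.
Qed.

End DoubleSaddle.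

(** * The homotopy on generators *)

Section Generators.
Variable D : link_diagram.
Implicit Types (S T : estate D) (x y : seq (crossing D)) (c : crossing D).

Lemma chain_ind (P : {pred chain D}) : GRing.submod_closed P ->
  (forall S x, listing S x -> gen S x \in P) -> forall u, u \in P.
Proof.
move=> Pcl Pgen u; have [P0 Plin] := Pcl.
have PZ k v : v \in P -> k *: v \in P.
  by move=> Pv; rewrite -[_ *: _]addr0; apply: Plin.
have PD v w : v \in P -> w \in P -> v + w \in P.
  by move=> Pv Pw; rewrite -[v]scale1r; apply: Plin.
rewrite -[u]reprK.
have -> : generic_quotient.repr u = \sum_(o : ostate D)
    ((generic_quotient.repr u) o : Zst) *: free_gen (val o).1 (val o).2.
  apply/ffunP => o; rewrite sum_ffunE (bigD1 o) //= big1 => [|o' oo'].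
    by rewrite !ffunE !eqxx addr0; exact: esym (mulr1 _).
  rewrite !ffunE; case: eqP => [e1|]; last by rewrite scaler0.
  case: eqP => [e2|]; last by rewrite scaler0.
  case/eqP: oo'; apply/val_inj; move: e1 e2 => /=.
  case: (sval o) (sval o') => [T z] [T1 z1] /= -> e; congr pair; exact/val_inj.
apply: (big_ind (fun v => \pi_(chain D)%qT v \in P)) => [|v w Pv Pw|o _].
- by rewrite raddf0.
- by rewrite raddfD; apply: PD.
- by rewrite pi_gen_scale; apply/PZ/Pgen/(valP o).
Qed.

Lemma gen_swap_cat S y z c d :
  gen S (y ++ c :: d :: z) = - gen S (y ++ d :: c :: z).
Proof.
have sw : perm_eq (y ++ c :: d :: z) (y ++ d :: c :: z).
  by rewrite perm_cat2l -[c :: d :: z]/([:: c; d] ++ z) perm_catC perm_sym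
    -[d :: c :: z]/([:: d; c] ++ z) perm_catC perm_cat2l (perm_catC [:: d] [:: c]).
have [yu|yu] := boolP (uniq (y ++ c :: d :: z)); last first.
  have nl w : ~~ uniq w -> gen S w = 0.
    by move=> wu; apply: gen_nlisting; rewrite /listing (negPf wu).
  by rewrite !nl ?oppr0 // -(perm_uniq sw).
have := yu; rewrite cat_uniq /= !inE !negb_or => /and3P[_ /and3P[cy dy _]].
case/and3P=> /andP[cd cz] dz _.
have fix_tperm w : c \notin w -> d \notin w -> [seq tperm c d e | e <- w] = w.
  move=> cw dw; rewrite -[RHS]map_id; apply/eq_in_map => e ew; apply: tpermD.
    by apply: contraNneq cw => ->.
  by apply: contraNneq dw => ->.
have <- : [seq tperm c d e | e <- y ++ c :: d :: z] = y ++ d :: c :: z.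
  by rewrite map_cat /= tpermL tpermR !fix_tperm.
rewrite gen_perm; last first.
  apply/subsetP => e; rewrite !inE mem_cat !inE.
  by case: tpermP => [->|->|_ _]; rewrite ?eqxx ?orbT.
by rewrite odd_tperm cd expr1 scaleN1r opprK.
Qed.

Lemma gen_swap S y c d : gen S (rcons (rcons y c) d) = - gen S (rcons (rcons y d) c).
Proof. by rewrite -!cats1 -!catA gen_swap_cat. Qed.

Lemma listing_swap S y c d :
  listing S (rcons (rcons y c) d) = listing S (rcons (rcons y d) c).
Proof.
have sw : perm_eq (rcons (rcons y c) d) (rcons (rcons y d) c).
  by rewrite -!cats1 -!catA perm_cat2l (perm_catC [:: c] [:: d]).
by rewrite /listing (perm_uniq sw); congr andb; apply: eq_forallb => e; rewrite (perm_mem sw).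
Qed.

Lemma saddle_outside Y u v S T : saddle Y u v S T != 0 -> outside_eq Y S T.
Proof. by rewrite /saddle; case: ifP; rewrite ?eqxx. Qed.

(** The condition on the marker of [T] is put into the coefficient, so that a sum over all states
    can be cut down to whichever site type is convenient. *)
Definition step_coef c S T : Zst :=
  if marker T c then 0 else saddle [set c] (c, 0) (c, 2) S T.

Definition step c S x : chain D := \sum_T step_coef c S T *: gen T (rcons x c).

Lemma step_coef_neq0 c S T : step_coef c S T != 0 ->
  [/\ ~~ marker T c, outside_eq [set c] S T & forall e, e != c -> marker T e = marker S e].
Proof.
rewrite /step_coef; case: ifP => [|_ /saddle_outside oST]; first by rewrite eqxx.
split=> // e ec; have /andP[/forallP/(_ e)] := oST.
by rewrite inE (negPf ec) => /eqP.
Qed.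

Lemma step_listing c S T x : listing S x -> marker S c -> step_coef c S T != 0 ->
  listing T (rcons x c).
Proof.
move=> Sx Sc /step_coef_neq0[Tc _ mT]; have /andP[xu _] := Sx.
apply/andP; split; first by rewrite rcons_uniq xu (listing_marker _ Sx) Sc.
apply/forallP => e; rewrite mem_rcons inE; have [->|ec] := eqVneq e c; first by rewrite Tc.
by rewrite mT //= (listing_marker _ Sx).
Qed.

Lemma delta_step S x : listing S x -> delta (gen S x) = \sum_(c | marker S c) step c S x.
Proof.
move=> Sx; rewrite deltaE; last exact: Sx.
apply: eq_bigr => c _; rewrite big_mkcond; apply: eq_bigr => T _.
rewrite /step_coef; case: ifP => [/negPf->|/negbFE->]; first exact: erefl.
by rewrite scale0r.
Qed.

End Generators.

(** * Sums over the states of one site type *)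

Section SiteSums.
Variables (D : link_diagram) (X : R2_site D).
Local Notation a := (ne X).1.
Local Notation b := (se X).1.
Implicit Types (S T : estate D) (x y : seq (crossing D)) (c : crossing D).

(* The sign [e] of the small circle is irrelevant unless the type is [+-]. *)
Definition typed ma mb e T :=
  site_type X T ma mb && (ma && ~~ mb ==> (small_sign X T == e)).

Lemma typed_small ma mb e S T : typed ma mb e S -> typed ma mb e T ->
  ma && ~~ mb -> small_sign X S = small_sign X T.
Proof. by rewrite /typed => + + m; rewrite m => /andP[_ /eqP->] /andP[_ /eqP->]. Qed.

Lemma typed_site ma mb e T : typed ma mb e T -> site_type X T ma mb.
Proof. by case/andP. Qed.

Lemma typed_resmooth S ma mb e : horizontal X (marker S) -> ma || ~~ mb ->
  typed ma mb e (resmooth X S ma mb e) /\ same_ends X S (resmooth X S ma mb e).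
Proof.
by move=> hS hm; have /and3P[? ? ?] := resmooth_spec e hS hm; rewrite /typed; split=> //; apply/andP.
Qed.

Lemma resmooth_eq S T ma mb e : horizontal X (marker S) -> ma || ~~ mb ->
  typed ma mb e T -> same_ends X S T -> T = resmooth X S ma mb e.
Proof.
move=> hS hm /andP[Tt Te] ST; apply/eqP; rewrite -resmoothP //.
by rewrite /resmoothed Tt ST Te.
Qed.

(** [resmooth] is a bijection between the states of two horizontal types with prescribed small sign;
    its inverse is [resmooth] in the other direction. *)
Lemma sum_resmooth (V : nmodType) ma mb e ma' mb' e' (F G : estate D -> V) :
  ma || ~~ mb -> ma' || ~~ mb' ->
  (forall T T', typed ma mb e T -> typed ma' mb' e' T' -> same_ends X T T' ->
    F T = G T') ->
  \sum_(T | typed ma mb e T) F T = \sum_(T | typed ma' mb' e' T) G T.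
Proof.
move=> hm hm' FG; have hor := fun T Tt => site_type_horizontal (@typed_site ma mb e T Tt) hm.
have hor' := fun T Tt => site_type_horizontal (@typed_site ma' mb' e' T Tt) hm'.
rewrite [RHS](reindex_onto (fun T => resmooth X T ma' mb' e')
  (fun T => resmooth X T ma mb e)) /=; last first.
  move=> T Tt; have [Rt TR] := typed_resmooth e (hor' T Tt) hm.
  apply/esym/resmooth_eq => //; first exact: hor.
  by rewrite same_endsC.
apply: eq_big => [T|T Tt]; last first.
  by have [Rt TR] := typed_resmooth e' (hor T Tt) hm'; apply: FG.
apply/idP/andP => [Tt|[Rt /eqP eT]].
  have [Rt TR] := typed_resmooth e' (hor T Tt) hm'; split=> //.
  apply/eqP/esym/resmooth_eq => //; first exact: hor'.
  by rewrite same_endsC.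
by have [+ _] := typed_resmooth e (hor' _ Rt) hm; rewrite eT.
Qed.

Lemma sum_same_ends (W : lmodType Zst) S ma mb e (F : estate D -> W) :
  horizontal X (marker S) -> ma || ~~ mb ->
  \sum_(T | typed ma mb e T) (same_ends X S T)%:R *: F T = F (resmooth X S ma mb e).
Proof.
move=> hS hm; have [Rt SR] := typed_resmooth e hS hm.
rewrite (bigD1 (resmooth X S ma mb e)) //= SR scale1r big1 ?addr0 // => T /andP[Tt].
case: (boolP (same_ends X S T)) => [ST|]; last by rewrite scale0r.
by rewrite (resmooth_eq hS hm Tt ST) eqxx.
Qed.

Lemma step_outer c S x ma mb e : c \notin [set a; b] -> typed ma mb e S ->
  step c S x = \sum_(T | typed ma mb e T) step_coef c S T *: gen T (rcons x c).
Proof.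
move=> cX /andP[/site_typeP[Sa Sb] Se]; rewrite [RHS]big_mkcond; apply: eq_bigr => T _.
case: ifP => // /negbT nT; have [->|nz] := eqVneq (step_coef c S T) 0; first by rewrite scale0r.
case/negP: nT; have [Tc _ _] := step_coef_neq0 nz.
have [|Ta Tb Te] := @saddle_outer_type _ X c S T cX.
  by move: nz; rewrite /step_coef (negPf Tc).
rewrite /typed /site_type Ta Tb Sa Sb !eqxx /=; apply/implyP => m.
by move: Te Se; rewrite Sa Sb m => <-.
Qed.

Lemma step_a S x mb : site_type X S true mb ->
  step a S x = \sum_(T | site_type X T false mb)
    saddle [set a] (a, 0) (a, 2) S T *: gen T (rcons x a).
Proof.
move=> /site_typeP[Sa Sb]; rewrite [RHS]big_mkcond; apply: eq_bigr => T _.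
have [z|nz] := eqVneq (step_coef a S T) 0; last first.
  have [Ta _ mT] := step_coef_neq0 nz.
  have Tb : marker T b = mb by rewrite mT // eq_sym site_neq.
  by rewrite /site_type Tb (negPf Ta) !eqxx /step_coef (negPf Ta).
rewrite z scale0r; case: ifP => // /site_typeP[Ta _].
by move: z; rewrite /step_coef Ta => ->; rewrite scale0r.
Qed.

Lemma step_b S x ma : site_type X S ma true ->
  step b S x = \sum_(T | site_type X T ma false)
    saddle [set b] (b, 0) (b, 2) S T *: gen T (rcons x b).
Proof.
move=> /site_typeP[Sa Sb]; rewrite [RHS]big_mkcond; apply: eq_bigr => T _.
have [z|nz] := eqVneq (step_coef b S T) 0; last first.
  have [Tb _ mT] := step_coef_neq0 nz.
  have Ta : marker T a = ma by rewrite mT // site_neq.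
  by rewrite /site_type Ta (negPf Tb) !eqxx /step_coef (negPf Tb).
rewrite z scale0r; case: ifP => // /site_typeP[_ Tb].
by move: z; rewrite /step_coef Tb => ->; rewrite scale0r.
Qed.

Lemma delta_site S x : listing S x -> delta (gen S x) =
  \sum_(c | marker S c && (c \notin [set a; b])) step c S x
  + ((if marker S a then step a S x else 0) + (if marker S b then step b S x else 0)).
Proof.
move=> Sx; rewrite delta_step; last exact: Sx.
rewrite (bigID (fun c => c \in [set a; b])) /= addrC; congr (_ + _).
have ab : a != b := site_neq X.
rewrite big_mkcondl /= (bigD1 a) ?inE ?eqxx //=; congr (_ + _).
rewrite (bigD1 b) /=; last by rewrite !inE eqxx orbT eq_sym.
by rewrite big1 ?addr0 // => c; rewrite !inE; case: (c == a); case: (c == b).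
Qed.

Lemma step_coef_same_ends c S S' T T' ma mb e ma' mb' e' :
  c \notin [set a; b] -> ma || ~~ mb -> ma' || ~~ mb' ->
  typed ma mb e S -> typed ma mb e T -> typed ma' mb' e' S' -> typed ma' mb' e' T' ->
  same_ends X S S' -> same_ends X T T' -> step_coef c S T = step_coef c S' T'.
Proof.
move=> cX hm hm' St Tt S't T't SS' TT'; rewrite /step_coef.
rewrite (same_ends_agree TT') //; case: ifP => // _.
exact: (saddle_outer cX hm hm' (typed_site St) (typed_site Tt) (typed_site S't)
  (typed_site T't) (typed_small St Tt) (typed_small S't T't) SS' TT').
Qed.

End SiteSums.

(** * The types [++], [-+], and [+-] with small sign [-] *)

Section Homotopy.
Variables (D : link_diagram) (X : R2_site D).
Local Notation a := (ne X).1.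
Local Notation b := (se X).1.
Local Notation C := (chain D).
Implicit Types (S T : estate D) (x y : seq (crossing D)) (c : crossing D).

(** The formulas for [h2] need a listing, which the target of a saddle is known to have only when
    its coefficient is nonzero. *)
Lemma scale_cond (V : lmodType Zst) (k : Zst) (u v : V) :
  (k != 0 -> u = v) -> k *: u = k *: v.
Proof. by have [->|nz /(_ isT)->] := eqVneq k 0; rewrite ?scale0r. Qed.

Lemma h2_sum (I : finType) (P : pred I) (k : I -> Zst) (u : I -> C) :
  h2 X (\sum_(i | P i) k i *: u i) = \sum_(i | P i) k i *: h2 X (u i).
Proof. by rewrite linear_sum; apply: eq_bigr => i _; rewrite linearZ. Qed.

Lemma h2D u v : h2 X (u + v) = h2 X u + h2 X v.
Proof. exact: linearD. Qed.

Lemma h2N u : h2 X (- u) = - h2 X u.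
Proof. exact: linearN. Qed.

Lemma h2_delta S x u v w : listing S x ->
  \sum_(c | marker S c && (c \notin [set a; b])) h2 X (step c S x) = u ->
  (if marker S a then h2 X (step a S x) else 0) = v ->
  (if marker S b then h2 X (step b S x) else 0) = w ->
  h2 X (delta (gen S x)) = u + (v + w).
Proof.
move=> Sx <- <- <-; rewrite (delta_site X Sx) !h2D; congr (_ + (_ + _)).
- exact: linear_sum.
- by case: ifP => _ //; exact: linear0.
- by case: ifP => _ //; exact: linear0.
Qed.

Lemma h2_resmooth_mm S y : site_type X S false false ->
  listing S (rcons (rcons y a) b) ->
  h2 X (gen S (rcons (rcons y a) b)) = - gen (resmooth X S true false false) (rcons y b).
Proof.
move=> St; rewrite -!cats1 -catA /= => Sx; rewrite h2_mmE; [|exact: St|exact: Sx].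
congr (- _); rewrite cats1; apply: big_pred1 => T /=.
rewrite -resmoothP //; last exact: site_type_horizontal St _.
by rewrite /resmoothed /= eqbF_neg; congr andb; rewrite andbC.
Qed.

Lemma h2_resmooth_pm S y e : site_type X S true false -> small_sign X S ->
  listing S (rcons y b) -> h2 X (gen S (rcons y b)) = gen (resmooth X S true true e) y.
Proof.
move=> St Se Sx; rewrite h2_pmE; [|exact: St|exact: Se|exact: Sx].
apply: big_pred1 => T /=; rewrite -resmoothP //; last exact: site_type_horizontal St _.
by rewrite /resmoothed /= andbT.
Qed.

Lemma h2_zero S x ma mb e : typed X ma mb e S ->
  ~~ (~~ ma && ~~ mb) -> ~~ [&& ma, ~~ mb & e] -> listing S x -> h2 X (gen S x) = 0.
Proof.
case/andP=> /site_typeP[Sa Sb] Se m1 m2; apply: h2_0.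
  by rewrite /site_type Sa Sb !eqbF_neg.
rewrite /site_type Sa Sb eqb_id eqbF_neg; apply: contra m2 => /andP[/andP[ha hb] es].
by move: Se; rewrite ha hb es /= => /eqP<-.
Qed.

Lemma rho2_zero S x ma mb e : typed X ma mb e S ->
  ~~ (~~ ma && mb) -> ~~ [&& ma, ~~ mb & e] -> listing S x -> val (rho2 X (gen S x)) = 0.
Proof.
case/andP=> /site_typeP[Sa Sb] Se m1 m2; apply: rho2_0.
  by rewrite /site_type Sa Sb eqbF_neg eqb_id.
rewrite /site_type Sa Sb eqb_id eqbF_neg; apply: contra m2 => /andP[/andP[ha hb] es].
by move: Se; rewrite ha hb es /= => /eqP<-.
Qed.

Lemma typedE ma mb e : ~~ (ma && ~~ mb) -> typed X ma mb e =1 (fun S => site_type X S ma mb).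
Proof. by move=> /negPf m S; rewrite /typed m andbT. Qed.

Lemma saddle_listing c S T x : listing S x -> marker S c -> marker T c = false ->
  saddle [set c] (c, 0) (c, 2) S T != 0 -> listing T (rcons x c).
Proof.
by move=> Sx Sc Tc nz; apply: (step_listing Sx Sc); rewrite /step_coef Tc.
Qed.

Lemma h2_step_outer_zero c S x ma mb e : c \notin [set a; b] -> marker S c ->
  typed X ma mb e S -> ~~ (~~ ma && ~~ mb) -> ~~ [&& ma, ~~ mb & e] -> listing S x ->
  h2 X (step c S x) = 0.
Proof.
move=> cX Sc St m1 m2 Sx; rewrite (step_outer x cX St) h2_sum; apply: big1 => T Tt.
rewrite -[RHS](scaler0 _ (step_coef c S T)); apply: scale_cond => nz.
exact: (h2_zero Tt m1 m2 (step_listing Sx Sc nz)).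
Qed.

Lemma homotopy_pp S y : site_type X S true true -> listing S y ->
  delta (h2 X (gen S y)) + h2 X (delta (gen S y)) = gen S y - incl (rho2 X (gen S y)).
Proof.
move=> St Sx; have tS : typed X true true false S by rewrite typedE.
have /site_typeP[Sa Sb] := St; have hS := site_type_horizontal St isT.
rewrite (h2_zero tS _ _ Sx) // linear0 add0r /incl (rho2_zero tS _ _ Sx) // subr0.
rewrite (@h2_delta S y 0 0 (gen S y) Sx) ?add0r; first exact: erefl.
- apply: big1 => c /andP[Sc cX].
  by apply: (h2_step_outer_zero cX Sc tS _ _ Sx).
- rewrite Sa (step_a y St) h2_sum; apply: big1 => T Tt.
  rewrite -[RHS](scaler0 _ (saddle [set a] (a, 0) (a, 2) S T)); apply: scale_cond => nz.
  have /site_typeP[Ta _] := Tt.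
  apply: (@h2_zero _ _ false true false) => //; first by rewrite typedE.
  exact: saddle_listing nz.
(* Of the states split off at [b], [h2] kills those with small sign [-]; by the counit law the
   others have the ends of [S], and [h2] restores [S]. *)
rewrite Sb (step_b y St) h2_sum (bigID (small_sign X)) /= [X in _ + X]big1; last first.
  move=> T /andP[Tt Te]; have /site_typeP[_ Tb] := Tt.
  rewrite -[RHS](scaler0 _ (saddle [set b] (b, 0) (b, 2) S T)); apply: scale_cond => nz.
  apply: (@h2_zero _ _ true false false) => //; first by rewrite /typed Tt eqbF_neg Te.
  exact: saddle_listing nz.
rewrite addr0 -[RHS](@sum_same_ends _ X _ S true false true (fun=> gen S y) hS isT).
apply: eq_big => [T|T /andP[Tt Te]]; first by rewrite /typed /= eqb_id.
rewrite (saddle_pp_pm_pos St Tt Te); apply: scale_cond => nz.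
have ST : same_ends X S T by case: same_ends nz => //; rewrite eqxx.
have /site_typeP[_ Tb] := Tt; have hT := site_type_horizontal Tt isT.
rewrite (h2_resmooth_pm true Tt Te); last first.
  by apply: saddle_listing Sx _ Tb _; rewrite ?Sb // (saddle_pp_pm_pos St Tt Te).
have TS : same_ends X T S by rewrite same_endsC.
have tS' : typed X true true true S by rewrite typedE.
by rewrite -(@resmooth_eq _ X T S true true true hT isT tS' TS).
Qed.

(** The saddle at [b] produces [E_{--}(p:q, q:p)], which [h2] turns into minus the second term of
    [rho2]. *)
Lemma homotopy_mp S y : site_type X S false true -> listing S (rcons y a) ->
  delta (h2 X (gen S (rcons y a))) + h2 X (delta (gen S (rcons y a)))
  = gen S (rcons y a) - incl (rho2 X (gen S (rcons y a))).
Proof.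
move=> St Sx; have tS : typed X false true false S by rewrite typedE.
have /site_typeP[Sa Sb] := St.
rewrite (h2_zero tS _ _ Sx) // linear0 add0r /incl (rho2_mpE St Sx).
rewrite opprD addrA subrr add0r -[RHS]add0r -[X in _ = _ + X]add0r.
apply: (h2_delta Sx).
- apply: big1 => c /andP[Sc cX].
  by apply: (h2_step_outer_zero cX Sc tS _ _ Sx).
- by rewrite Sa.
rewrite Sb (step_b _ St) h2_sum /saddle_pm.
have -> : - \sum_(T | site_type X T true false && ~~ small_sign X T)
    site_saddle X S T *: gen T (rcons y b) =
    \sum_(T | typed X true false false T) saddle_coef X S T *: - gen T (rcons y b).
  rewrite -sumrN; apply: eq_big => [T|T /andP[Tt _]]; first by rewrite /typed /= eqbF_neg.
  by rewrite site_saddle_coef ?St ?Tt ?orbT // scalerN.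
transitivity (\sum_(T | typed X false false false T) saddle_coef X S T *:
    - gen (resmooth X T true false false) (rcons y b)).
  apply: eq_big => [T|T Tt]; first by rewrite typedE.
  rewrite (saddle_coef_mp_mm St Tt); apply: scale_cond => nz.
  have /site_typeP[_ Tb] := Tt; rewrite h2_resmooth_mm; [exact: erefl|exact: Tt|].
  by apply: (saddle_listing Sx _ Tb); rewrite ?Sb // (saddle_coef_mp_mm St Tt).
apply: (@sum_resmooth _ X _ false false false true false false _ _ isT isT).
move=> T T' Tt T't TT'.
have hT := site_type_horizontal (typed_site Tt) isT.
by rewrite (saddle_coef_r _ TT') -(@resmooth_eq _ X T T' true false false hT isT T't TT').
Qed.

(** The saddle at [a] merges the small circle by the unit law into [E_{--}(p,q)] with the list
    [xba]. Reordering to [xab] gives a sign that cancels the one in [h2], so [S] comes back. *)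
Lemma homotopy_pm_neg S y : site_type X S true false -> ~~ small_sign X S ->
  listing S (rcons y b) ->
  delta (h2 X (gen S (rcons y b))) + h2 X (delta (gen S (rcons y b)))
  = gen S (rcons y b) - incl (rho2 X (gen S (rcons y b))).
Proof.
move=> St Se Sx; have tS : typed X true false false S by rewrite /typed St eqbF_neg.
have /site_typeP[Sa Sb] := St; have hS := site_type_horizontal St isT.
rewrite (h2_zero tS _ _ Sx) // linear0 add0r /incl (rho2_zero tS _ _ Sx) // subr0.
rewrite -[RHS]add0r -[X in _ = _ + X]addr0.
apply: (h2_delta Sx).
- apply: big1 => c /andP[Sc cX].
  by apply: (h2_step_outer_zero cX Sc tS _ _ Sx).
- rewrite Sa (step_a _ St) h2_sum.
  rewrite -[RHS](@sum_same_ends _ X _ S false false false (fun=> gen S (rcons y b)) hS isT).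
  apply: eq_big => [T|T Tt]; first by rewrite typedE.
  rewrite (saddle_pm_mm_neg St Se Tt); apply: scale_cond => nz.
  have ST : same_ends X S T by case: same_ends nz => //; rewrite eqxx.
  have /site_typeP[Ta _] := Tt; have hT := site_type_horizontal Tt isT.
  have TS : same_ends X T S by rewrite same_endsC.
  have Tx : listing T (rcons (rcons y b) a).
    by apply: (saddle_listing Sx _ Ta); rewrite ?Sa // (saddle_pm_mm_neg St Se Tt).
  rewrite gen_swap h2N h2_resmooth_mm; [|exact: Tt|by rewrite listing_swap].
  by rewrite opprK -(@resmooth_eq _ X T S true false false hT isT tS TS).
by rewrite Sb.
Qed.

End Homotopy.

(** * The type [+-] with small sign [+], and the type [--] *)

Section HomotopyCases.
Variables (D : link_diagram) (X : R2_site D).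
Local Notation a := (ne X).1.
Local Notation b := (se X).1.
Implicit Types (S T : estate D) (x y : seq (crossing D)) (c : crossing D).

Lemma delta_site_eq S x u v w : listing S x ->
  \sum_(c | marker S c && (c \notin [set a; b])) step c S x = u ->
  (if marker S a then step a S x else 0) = v ->
  (if marker S b then step b S x else 0) = w ->
  delta (gen S x) = u + (v + w).
Proof. by move=> Sx <- <- <-; rewrite (delta_site X Sx). Qed.

Lemma scale_congr (V : lmodType Zst) (k l : Zst) (u : V) : k = l -> k *: u = l *: u.
Proof. by move=> ->. Qed.

(** Here [o] stands for the outer terms, [m] for [saddle_mp], [g] for the generator, and [u], [v]
    for the two remainders whose sum is the double saddle. *)
Lemma rearrange (V : zmodType) (o m g u v : V) :
  o + (m + (g + u)) + (- o + (v + 0)) = g - (- m - (u + v)).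
Proof.
rewrite addr0 opprB opprK addrACA [o + _]addrC !addrA addNr add0r.
by rewrite -[in LHS]addrA -[in LHS]addrA [LHS]addrC !addrA.
Qed.

Lemma homotopy_pm_pos S y : site_type X S true false -> small_sign X S ->
  listing S (rcons y b) ->
  delta (h2 X (gen S (rcons y b))) + h2 X (delta (gen S (rcons y b)))
  = gen S (rcons y b) - incl (rho2 X (gen S (rcons y b))).
Proof.
move=> St Se Sx; have tS : typed X true false true S by rewrite /typed St eqb_id.
have /site_typeP[Sa Sb] := St; have hS := site_type_horizontal St isT.
have [t0 SS0] := typed_resmooth true hS (isT : true || ~~ true).
rewrite (h2_resmooth_pm true St Se Sx).
move: (resmooth X S true true true) t0 SS0 => S0 tS0 SS0.
have S0t := typed_site tS0; have /site_typeP[S0a S0b] := S0t.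
have hS0 := site_type_horizontal S0t isT.
have S0c c : c \notin [set a; b] -> marker S0 c = marker S c.
  by move=> cX; rewrite (same_ends_agree SS0).
have S0y : listing S0 y.
  have /andP[] := Sx; rewrite rcons_uniq => /andP[yb yu] _; apply/andP; split=> //.
  apply/forallP => c; have [->|cb] := eqVneq c b; first by rewrite S0b (negPf yb).
  have -> : (c \in y) = ~~ marker S c.
    by rewrite -(listing_marker _ Sx) mem_rcons inE (negPf cb).
  have [->|ca] := eqVneq c a; first by rewrite Sa S0a.
  by rewrite S0c // !inE (negPf ca).
pose out := \sum_(c | marker S c && (c \notin [set a; b])) step c S0 y.
have dE : delta (gen S0 y) = out + (saddle_mp X S y + step b S0 y).
  apply: (delta_site_eq S0y); last by rewrite S0b.
    by apply: eq_bigl => c; case: (boolP (c \in _)) => cX; rewrite ?andbF // !andbT S0c.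
  rewrite S0a (step_a y S0t) /saddle_mp; apply: eq_bigr => T Tt; apply: scale_congr.
  have e : site_type X S true false && site_type X T false true by rewrite St Tt.
  by rewrite (saddle_coef_pp_mp S0t Tt) site_saddle_coef ?e // (saddle_coef_l _ hS hS0 SS0).
have hE : h2 X (delta (gen S (rcons y b))) =
    - out + (h2 X (step a S (rcons y b)) + 0).
  apply: (h2_delta Sx); [|by rewrite Sa|by rewrite Sb].
  rewrite /out -sumrN; apply: eq_bigr => c /andP[Sc cX].
  rewrite (step_outer _ cX tS) (step_outer _ cX tS0) h2_sum -sumrN.
  apply: (@sum_resmooth _ X _ true false true true true true _ _ isT isT).
  move=> T T' Tt T't TT'; have hT := site_type_horizontal (typed_site Tt) isT.
  have cE := @step_coef_same_ends _ X c S S0 T T' true false true true true true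
    cX isT isT tS Tt tS0 T't SS0 TT'.
  rewrite cE -scalerN.
  (* The new crossing [c] stands behind [b] and has to pass it before [h2] removes [b]. *)
  apply: scale_cond => nz; rewrite gen_swap h2N; congr (- _).
  have /andP[Tt' /eqP Te] := Tt.
  rewrite (h2_resmooth_pm true Tt' Te).
    by rewrite -(@resmooth_eq _ X T T' true true true hT isT T't TT').
  rewrite listing_swap; apply: (step_listing Sx Sc).
  by rewrite cE.
have bE : step b S0 y = gen S (rcons y b) +
    \sum_(T | typed X true false false T)
      saddle [set b] (b, 0) (b, 2) S0 T *: gen T (rcons y b).
  rewrite (step_b y S0t) (bigID (small_sign X)) /=; congr (_ + _).
    have S0S : same_ends X S0 S by rewrite same_endsC.
    transitivity (gen (resmooth X S0 true false true) (rcons y b)); last first.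
      by rewrite -(@resmooth_eq _ X S0 S true false true hS0 isT tS S0S).
    rewrite -(@sum_same_ends _ X _ S0 true false true
      (fun T => gen T (rcons y b)) hS0 isT).
    apply: eq_big => [T|T /andP[Tt Te]]; first by rewrite /typed /= eqb_id.
    by apply: scale_congr; rewrite (saddle_pp_pm_pos S0t Tt Te).
  by apply: eq_bigl => T; rewrite /typed /= eqbF_neg.
have aE : h2 X (step a S (rcons y b)) =
    \sum_(T | typed X true false false T)
      saddle [set a] (a, 0) (a, 2) S (resmooth X T false false false)
        *: gen T (rcons y b).
  rewrite (step_a _ St) h2_sum.
  rewrite [LHS](_ : _ = \sum_(T | typed X false false false T)
     saddle [set a] (a, 0) (a, 2) S T *: h2 X (gen T (rcons (rcons y b) a))); last first.
    by apply: eq_bigl => T; rewrite typedE.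
  apply: (@sum_resmooth _ X _ false false false true false false _ _ isT isT).
  move=> T T' Tt T't TT'; have hT := site_type_horizontal (typed_site Tt) isT.
  have hT' := site_type_horizontal (typed_site T't) isT.
  have T'T : same_ends X T' T by rewrite same_endsC.
  rewrite -(@resmooth_eq _ X T' T false false false hT' isT Tt T'T).
  apply: scale_cond => nz; have /site_typeP[Ta _] := typed_site Tt.
  have Tx : listing T (rcons (rcons y b) a).
    by apply: (saddle_listing Sx _ Ta nz); rewrite Sa.
  (* The sign of exchanging [a] and [b] cancels the sign of [h2] on [E_{--}]. *)
  rewrite gen_swap h2N h2_resmooth_mm; [|exact: typed_site Tt|by rewrite listing_swap].
  by rewrite opprK -(@resmooth_eq _ X T T' true false false hT isT T't TT').
have DE : double_saddle X S y = \sum_(T | typed X true false false T)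
    (saddle [set b] (b, 0) (b, 2) S0 T
     + saddle [set a] (a, 0) (a, 2) S (resmooth X T false false false))
      *: gen T (rcons y b).
  rewrite /double_saddle /saddle_pm.
  rewrite [LHS](_ : _ = \sum_(T' | site_type X T' false true)
     \sum_(T | typed X true false false T)
       (site_saddle X S T' * site_saddle X T' T) *: gen T (rcons y b)); last first.
    apply: eq_bigr => T' _; rewrite scaler_sumr; apply: eq_big => [T|T _].
      by rewrite /typed /= eqbF_neg.
    by rewrite scalerA.
  rewrite exchange_big /=; apply: eq_bigr => T Tt; rewrite -scaler_suml.
  have hT := site_type_horizontal (typed_site Tt) isT.
  have [tU TU] := typed_resmooth false hT (isT : false || ~~ false).
  have /andP[Tt' /eqP Te] := Tt; congr (_ *: _).
  by apply: (double_saddle_coef St Se S0t SS0 Tt' _ (typed_site tU) TU); rewrite Te.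
rewrite dE hE bE aE /incl (rho2_pmE St Se Sx) DE.
under [in RHS]eq_bigr do rewrite scalerDl.
rewrite big_split /=.
exact: rearrange.
Qed.

Lemma gen_rotate3 S y c d e :
  gen S (rcons (rcons (rcons y c) d) e) = gen S (rcons (rcons (rcons y e) c) d).
Proof.
rewrite gen_swap -!cats1 -!catA /=.
by rewrite (gen_swap_cat S y [:: d]) opprK.
Qed.

Lemma listing_rotate3 S y c d e :
  listing S (rcons (rcons (rcons y c) d) e) = listing S (rcons (rcons (rcons y e) c) d).
Proof.
have sw : perm_eq (rcons (rcons (rcons y c) d) e) (rcons (rcons (rcons y e) c) d).
  by rewrite -!cats1 -!catA perm_cat2l (perm_catC [:: c; d] [:: e]).
by rewrite /listing (perm_uniq sw); congr andb; apply: eq_forallb => x; rewrite (perm_mem sw).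
Qed.

(** Both site markers are negative, so [h2 \o delta] has outer terms only. In [delta \o h2] the
    saddle at [a] merges the small circle of sign [-] back, and the sign of [h2] cancels that of
    reordering [xba]. *)
Lemma homotopy_mm S y : site_type X S false false -> listing S (rcons (rcons y a) b) ->
  delta (h2 X (gen S (rcons (rcons y a) b))) + h2 X (delta (gen S (rcons (rcons y a) b)))
  = gen S (rcons (rcons y a) b) - incl (rho2 X (gen S (rcons (rcons y a) b))).
Proof.
move=> St Sx; have tS : typed X false false false S by rewrite typedE.
have /site_typeP[Sa Sb] := St; have hS := site_type_horizontal St isT.
have [t1 SS1] := typed_resmooth false hS (isT : true || ~~ false).
rewrite (h2_resmooth_mm St Sx) /incl (rho2_zero tS _ _ Sx) // subr0.
move: (resmooth X S true false false) t1 SS1 => S1 tS1 SS1.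
have S1t := typed_site tS1; have /site_typeP[S1a S1b] := S1t.
have hS1 := site_type_horizontal S1t isT.
have S1c c : c \notin [set a; b] -> marker S1 c = marker S c.
  by move=> cX; rewrite (same_ends_agree SS1).
have S1y : listing S1 (rcons y b).
  have /andP[] := Sx; rewrite !rcons_uniq !mem_rcons inE negb_or.
  move=> /andP[/andP[ba yb] /andP[ya yu]] _; apply/andP; split.
    by rewrite rcons_uniq yb.
  apply/forallP => c; have [->|ca] := eqVneq c a.
    by rewrite S1a mem_rcons inE [a == b]eq_sym (negPf ba) (negPf ya).
  have -> : (c \in rcons y b) = ~~ marker S c.
    by rewrite -(listing_marker _ Sx) !mem_rcons !inE mem_rcons inE (negPf ca).
  have [->|cb] := eqVneq c b; first by rewrite Sb S1b.
  by rewrite S1c // !inE (negPf ca).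
pose out := \sum_(c | marker S c && (c \notin [set a; b])) step c S1 (rcons y b).
have dE : delta (gen S1 (rcons y b)) = out + (- gen S (rcons (rcons y a) b) + 0).
  apply: (delta_site_eq S1y); last by rewrite S1b.
    by apply: eq_bigl => c; case: (boolP (c \in _)) => cX; rewrite ?andbF // !andbT S1c.
  rewrite S1a (step_a _ S1t) -gen_swap.
  have S1S : same_ends X S1 S by rewrite same_endsC.
  transitivity (gen (resmooth X S1 false false false) (rcons (rcons y b) a)); last first.
    by rewrite -(@resmooth_eq _ X S1 S false false false hS1 isT tS S1S).
  rewrite -(@sum_same_ends _ X _ S1 false false false
    (fun T => gen T (rcons (rcons y b) a)) hS1 isT).
  apply: eq_big => [T|T Tt]; first by rewrite typedE.
  have /andP[_ /eqP S1e] := tS1.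
  by apply: scale_congr; rewrite (saddle_pm_mm_neg S1t _ Tt) // S1e.
have hE : h2 X (delta (gen S (rcons (rcons y a) b))) = out + (0 + 0).
  apply: (h2_delta Sx); [|by rewrite Sa|by rewrite Sb].
  apply: eq_bigr => c /andP[Sc cX].
  rewrite (step_outer _ cX tS) (step_outer _ cX tS1) h2_sum.
  apply: (@sum_resmooth _ X _ false false false true false false _ _ isT isT).
  move=> T T' Tt T't TT'; have hT := site_type_horizontal (typed_site Tt) isT.
  have cE := @step_coef_same_ends _ X c S S1 T T' false false false true false false
    cX isT isT tS Tt tS1 T't SS1 TT'.
  rewrite -cE; apply: scale_cond => nz; rewrite gen_rotate3.
  rewrite (h2_resmooth_mm (typed_site Tt)); last first.
    by rewrite -listing_rotate3; apply: (step_listing Sx Sc nz).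
  by rewrite -gen_swap -(@resmooth_eq _ X T T' true false false hT isT T't TT').
rewrite hE; transitivity (- delta (gen S1 (rcons y b)) + (out + (0 + 0))).
  by congr (_ + _); exact: linearN.
by rewrite dE !addr0 opprD opprK addrAC addNr add0r.
Qed.

End HomotopyCases.

(** * The degree of the homotopy, and extension from generators to all chains *)

Section Conclusion.
Variables (D : link_diagram) (X : R2_site D).
Local Notation a := (ne X).1.
Local Notation b := (se X).1.
Implicit Types (S T : estate D) (x y : seq (crossing D)) (c : crossing D).

(** [sigma] grows by 2, and a multiple of 2 passes through the integer division whatever the parity
    of the rest. *)
Lemma state_degree_flip S T c : marker S c = false -> marker T c ->
  (forall d, d != c -> marker T d = marker S d) ->
  state_degree T = state_degree S - 1.
Proof.
move=> Sc Tc mST; have sE : sigma T = sigma S + 2.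
  rewrite /sigma (bigD1 c) //= [in RHS](bigD1 c) //= Sc Tc.
  rewrite (eq_bigr (fun d => if marker S d then 1 else -1)) => [|d /mST-> //].
  by rewrite [-1 + _]addrC -addrA [LHS]addrC.
rewrite /state_degree sE opprD addrA addrC [RHS]addrC.
by rewrite -[- 2%:R]mulN1r divzMDl.
Qed.

Lemma chain_deg_closed i : GRing.submod_closed (@chain_deg D i).
Proof. exact: submod_gen_closed. Qed.

Lemma chain_deg_gen i S x : state_degree S = i -> gen S x \in chain_deg i.
Proof.
move=> Si; case: (boolP (listing S x)) => Sx; last first.
  by rewrite (gen_nlisting Sx) /chain_deg rpred0.
by apply: submod_gen_mem; exists S, x.
Qed.

Lemma h2_degree i u : u \in chain_deg i -> h2 X u \in chain_deg (i - 1).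
Proof.
move=> /asboolP H; have := H [pred v | h2 X v \in chain_deg (i - 1)]; apply.
  split=> [|k v w]; rewrite !inE.
    by have -> : h2 X 0 = 0; [exact: linear0|exact: rpred0].
  move=> hv hw; have -> : h2 X (k *: v + w) = k *: h2 X v + h2 X w by exact: linearP.
  by have [_ lin] := chain_deg_closed (i - 1); exact (lin k _ _ hv hw).
move=> g [S [x [Sx Si ->]]]; rewrite inE /h2 (extend_gen (h2_compatible X)) // /h2_gen.
case: ifP => [/site_typeP[Sa Sb]|_].
  apply: rpredZ; rewrite /h2_mm -scaleN1r; apply: rpredZ.
  apply: rpred_sum => T /and3P[/site_typeP[Ta Tb] _ ST]; apply: chain_deg_gen.
  rewrite -Si; apply: (@state_degree_flip _ _ a) => // c ca.
  have [->|cb] := eqVneq c b; first by rewrite Sb Tb.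
  by rewrite (same_ends_agree ST) // !inE negb_or ca.
case: ifP => [/andP[/site_typeP[Sa Sb] _]|_]; last exact: rpred0.
apply: rpredZ; rewrite /h2_pm.
apply: rpred_sum => T /andP[/site_typeP[Ta Tb] ST]; apply: chain_deg_gen.
rewrite -Si; apply: (@state_degree_flip _ _ b) => // c cb.
have [->|ca] := eqVneq c a; first by rewrite Sa Ta.
by rewrite (same_ends_agree ST) // !inE negb_or ca.
Qed.

Lemma lin_comb (V : lmodType Zst) (k : Zst) (p p' q q' v w r t : V) :
  p + p' = v - r -> q + q' = w - t ->
  k *: p + q + (k *: p' + q') = k *: v + w - (k *: r + t).
Proof. by move=> e1 e2; rewrite addrACA -scalerDr e1 e2 scalerBr opprD addrACA. Qed.

Lemma homotopy u : delta (h2 X u) + h2 X (delta u) = u - incl (rho2 X u).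
Proof.
pose P := [pred u : chain D | delta (h2 X u) + h2 X (delta u) == u - incl (rho2 X u)].
have P_closed : GRing.submod_closed P.
  have lin k (v w : chain D) : v \in P -> w \in P -> k *: v + w \in P.
    rewrite !inE => /eqP Pv /eqP Pw; apply/eqP.
    have -> : incl (rho2 X (k *: v + w)) = k *: incl (rho2 X v) + incl (rho2 X w).
      exact: (extend_linear (rho2_compatible X) k v w).
    rewrite [h2 X (k *: v + w)]linearP [delta (k *: v + w)]linearP.
    rewrite [h2 X (k *: _ + _)]linearP [delta (k *: _ + _)]linearP.
    exact (lin_comb k Pv Pw).
  split; last exact: lin.
  rewrite inE; apply/eqP.
  have -> : incl (rho2 X 0) = 0 by rewrite /incl linear0.
  by rewrite [h2 X 0]linear0 [delta 0]linear0 [h2 X 0]linear0 subr0 addr0.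
apply/eqP; apply: (chain_ind P_closed) => S x Sx.
have [ma [mb St]] : exists ma mb, site_type X S ma mb.
  by exists (marker S a), (marker S b); apply/site_typeP.
(* Up to sign, any listing can be reordered so that the site crossings stand at its end, as the case
   lemmas require. *)
have [s xs sx] : exists2 s : {perm crossing D}, perm_on [set c in x] s
    & outer X x ++ inside X ma mb = [seq s c | c <- x].
  apply: perm_signP; first by case/andP: Sx.
  by rewrite perm_sym (outer_inside St Sx).
have Sy := listing_outer St Sx.
have -> : gen S x = (-1) ^+ s *: gen S (outer X x ++ inside X ma mb).
  by rewrite sx (gen_perm _ xs) scalerA -signr_addb addbb scale1r.
have [P0 Plin] := P_closed; rewrite -[_ *: _]addr0; apply: Plin P0.
move: (outer X x) Sy => y {x s Sx xs sx}; rewrite inE /inside => Sy; apply/eqP.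
move: St Sy; case: ma; case: mb; rewrite /= ?cats0 ?cats1 => St Sy.
- exact: homotopy_pp.
- case: (boolP (small_sign X S)) => Se; first exact: homotopy_pm_pos.
  exact: homotopy_pm_neg.
- exact: homotopy_mp.
- have e : y ++ [:: a; b] = rcons (rcons y a) b by rewrite -!cats1 -catA.
  by rewrite e; rewrite e in Sy; apply: homotopy_mm.
Qed.

End Conclusion.

Theorem theorem4p13 (D : link_diagram) (X : R2_site D) :
  (forall (i : int) (u : chain D),
      u \in chain_deg i -> h2 X u \in chain_deg (i - 1)) /\
  (forall u : chain D,
      delta (h2 X u) + h2 X (delta u) = u - incl (rho2 X u)).
Proof. by split=> [i u|u]; [exact: h2_degree|exact: homotopy]. Qed.
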